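(* Let $n$ be odd, $r\ge 1$, $v\in\mathbb{C}^\times$, $\lambda=(\lambda_1\ge\dots\ge\lambda_r\ge0)$ an integer partition, $\mathbf z=(z_1,\dots,z_r)\in(\mathbb{C}^{\times})^r$ and $\mathbf c=(c_1,\dots,c_r)\in\mathbb{Z}^r$ with every $c_k\in[0,n-1]$. Let $Z_\lambda(\mathbf z;\mathbf c)$ be the partition function of symplectic ice with prescribed left charges, as defined in the context. Let $1\le i<r$ and $j=i+1$, let $s_i$ be the transposition interchanging the $i$-th and $j$-th entries of an $r$-tuple, and let $e\equiv c_i-c_j\pmod n$ with $e\in[0,n-1]$. If $c_i\neq c_j$, then $$(1-v)\,z_i^{\,n-e}z_j^{\,e}\,Z_\lambda(\mathbf z;\mathbf c)+g(c_i-c_j)\,(z_j^n-z_i^n)\,Z_\lambda(\mathbf z;s_i(\mathbf c))=(z_j^n-vz_i^n)\,Z_\lambda(s_i(\mathbf z);\mathbf c).$$ If $c_i=c_j$, then $$(z_i^n-vz_j^n)\,Z_\lambda(\mathbf z;\mathbf c)=(z_j^n-vz_i^n)\,Z_\lambda(s_i(\mathbf z);\mathbf c).$$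
   Context: Functions: $g:\mathbb{Z}\to\mathbb{C}$ is periodic modulo $n$ with $g(0)=-v$ and $g(a)g(n-a)=v$ whenever $n\nmid a$; $\delta(a)=1$ if $n\mid a$ and $0$ otherwise; $h(a)=(1-v)\delta(a)$. **Symplectic ice.** Let $\rho=(r,r-1,\dots,1)$. Take a rectangular lattice with $\lambda_1+r$ columns, numbered $1,2,\dots,\lambda_1+r$ from right to left, and $2r$ rows labelled $1,\overline1,2,\overline2,\dots,r,\overline r$ from top to bottom, with a vertex at each intersection. Each row has $\lambda_1+r+1$ horizontal edges; for each $i$, the rightmost edges of rows $i$ and $\overline i$ are joined by a bend containing one bend vertex. Every edge carries a spin $+$ or $-$. Boundary conditions: all spins on the left and bottom boundaries are $+$; the top boundary spin is $-$ in the columns numbered by the parts $\lambda_k+r+1-k$ of $\lambda+\rho$, and $+$ in the other columns. A state is an assignment of spins to the remaining edges. It is admissible if the two edges at every bend have different spins and every other vertex has one of the six configurations (left, right; top, bottom): $a_1=(+,+;+,+)$, $a_2=(-,-;-,-)$, $b_1=(+,+;-,-)$, $b_2=(-,-;+,+)$, $c_1=(-,+;+,-)$, $c_2=(+,-;-,+)$. Let $\mathfrak S_\lambda$ be the set of admissible states. **Charge.** In row $i$ (''$\Delta$ ice'') the charge at a horizontal edge is the number of $-$ spins on horizontal edges of the row at and to the left of it; the charge at a vertex is the charge at its left edge; the charge at the bend vertex joining rows $i,\overline i$ is the charge at the rightmost edge of row $i$. In row $\overline i$ (''$\Gamma$ ice'') the charge at a horizontal edge is the charge at the bend vertex plus the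 number of $+$ spins on horizontal edges of the row at and to the right of it; the charge at a vertex is the charge at its right edge. **Weights.** A vertex of charge $a$ in row $i$ has weight: $a_1:1$, $a_2:g(a)z_i$, $b_1:1$, $b_2:z_i$, $c_1:h(a)z_i$, $c_2:\delta(a)$. A vertex of charge $a$ in row $\overline i$ has weight: $a_1:1$, $a_2:z_i^{-1}$, $b_1:g(a)$, $b_2:z_i^{-1}$, $c_1:h(a)z_i^{-1}$, $c_2:\delta(a)$. A bend joining rows $i,\overline i$ with bend vertex of charge $a$ has weight $g(2a)z_i$ if its row-$i$ edge is $-$ and its row-$\overline i$ edge is $+$, and weight $z_i^{-1}$ if its row-$i$ edge is $+$ and its row-$\overline i$ edge is $-$. The weight $\mathrm{wt}(\mathfrak s)$ of an admissible state is the product of the weights of all its vertices, including bend vertices. $Z_\lambda(\mathbf z;\mathbf c)$ is the sum of $\mathrm{wt}(\mathfrak s)$ over all $\mathfrak s\in\mathfrak S_\lambda$ for which, for every $k$, the charge at the leftmost edge of row $\overline k$ is congruent to $c_k$ modulo $n$. *)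

(* Defs.v *)
From mathcomp Require Import all_boot all_order all_algebra.
From mathcomp Require Import perm.

Set Implicit Arguments.
Unset Strict Implicit.
Unset Printing Implicit Defensive.

Import Order.TTheory GRing.Theory Num.Theory.
Local Open Scope ring_scope.

(** Symplectic ice with r pairs of rows and N columns.

    The indices k = 1, ..., r are represented by 'I_r, so the k-th index has
    value k - 1. The row (k, false) is the row k (Delta ice), and (k, true) is
    the row k-bar (Gamma ice). The columns are represented by 'I_N, from right
    to left: c : 'I_N is the column numbered c + 1.

    In each row the horizontal edges are indexed by 'I_N.+1, also from right to
    left: ord0 is the rightmost edge and ord_max the leftmost one. In each
    column the vertical edges are indexed by 'I_(r.*2).+1 from top to bottom. *)

Notation spin := bool (only parsing).
Notation spin_plus := false (only parsing).
Notation spin_minus := true (only parsing).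

Definition swap (T : Type) (r : nat) (i j : 'I_r) (x : 'I_r -> T) : 'I_r -> T :=
  fun k => x (tperm i j k).

(** All edges carry a spin, the boundary ones included; the boundary conditions
    are part of [admissible]. *)
Definition state (r N : nat) : Type :=
  ({ffun 'I_r * bool * 'I_N.+1 -> bool} * {ffun 'I_(r.*2).+1 * 'I_N -> bool})%type.

Variant six_vertex := A1 | A2 | B1 | B2 | C1 | C2.

Definition six_vertex_of (left right top bottom : spin) : option six_vertex :=
  match left, right, top, bottom with
  | spin_plus,  spin_plus,  spin_plus,  spin_plus  => Some A1
  | spin_minus, spin_minus, spin_minus, spin_minus => Some A2
  | spin_plus,  spin_plus,  spin_minus, spin_minus => Some B1
  | spin_minus, spin_minus, spin_plus,  spin_plus  => Some B2
  | spin_minus, spin_plus,  spin_plus,  spin_minus => Some C1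
  | spin_plus,  spin_minus, spin_minus, spin_plus  => Some C2
  | _, _, _, _ => None
  end.

Section Ice.
Variables (r N : nat).
Implicit Types (s : state r N) (k : 'I_r) (b : bool) (c : 'I_N) (e : 'I_N.+1).

Definition hspin s k b e : spin := s.1 (k, b, e).
Definition vspin s (p : 'I_(r.*2).+1) c : spin := s.2 (p, c).

Definition left_edge c : 'I_N.+1 := lift ord0 c.
Definition right_edge c : 'I_N.+1 := widen_ord (leqnSn N) c.
(** The row (k, b) lies between the vertical edges of index 2k + b and 2k + b + 1;
    both are at most 2r, so [inord] never truncates. *)
Definition top_edge k b : 'I_(r.*2).+1 := inord (k.*2 + b).
Definition bottom_edge k b : 'I_(r.*2).+1 := inord (k.*2 + b).+1.

Definition vertex_config s k b c : option six_vertex :=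
  six_vertex_of (hspin s k b (left_edge c)) (hspin s k b (right_edge c))
                (vspin s (top_edge k b) c) (vspin s (bottom_edge k b) c).

(** Column c + 1 is numbered by a part of lambda + rho: with the 0-based k, the
    corresponding part is lambda_(k+1) + r + 1 - (k + 1). *)
Definition top_minus (lam : r.-tuple nat) c : bool :=
  [exists k : 'I_r, c.+1 == (tnth lam k + (r - k))%N].

Definition admissible (lam : r.-tuple nat) s : bool :=
  [&& [forall k, forall b, hspin s k b ord_max == spin_plus],
      [forall c, vspin s ord_max c == spin_plus],
      [forall c, vspin s ord0 c ==
                   (if top_minus lam c then spin_minus else spin_plus)],
      [forall k, hspin s k false ord0 != hspin s k true ord0]
    & [forall k, forall b, forall c, isSome (vertex_config s k b c)]].

Definition charge_delta s k e : nat :=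
  #|[set e' : 'I_N.+1 | (e <= e')%N & hspin s k false e' == spin_minus]|.

Definition charge_bend s k : nat := charge_delta s k ord0.

Definition charge_gamma s k e : nat :=
  (charge_bend s k +
   #|[set e' : 'I_N.+1 | (e' <= e)%N & hspin s k true e' == spin_plus]|)%N.

Section Weights.
Variables (F : fieldType) (n : nat) (v : F) (g : int -> F) (z : 'I_r -> F).

Definition delta (a : int) : F := (n %| a)%Z%:R.
Definition h (a : int) : F := (1 - v) * delta a.

(** The value on [None] is irrelevant: it does not occur in admissible states. *)
Definition weight_delta s k c : F :=
  let a : int := charge_delta s k (left_edge c) in
  match vertex_config s k false c with
  | Some A1 => 1
  | Some A2 => g a * z k
  | Some B1 => 1
  | Some B2 => z k
  | Some C1 => h a * z k
  | Some C2 => delta a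
  | None => 0
  end.

Definition weight_gamma s k c : F :=
  let a : int := charge_gamma s k (right_edge c) in
  match vertex_config s k true c with
  | Some A1 => 1
  | Some A2 => (z k)^-1
  | Some B1 => g a
  | Some B2 => (z k)^-1
  | Some C1 => h a * (z k)^-1
  | Some C2 => delta a
  | None => 0
  end.

(** The two edges at a bend of an admissible state have different spins, so the
    other two cases are irrelevant. *)
Definition weight_bend s k : F :=
  let a : int := charge_bend s k in
  match hspin s k false ord0, hspin s k true ord0 with
  | spin_minus, spin_plus => g (2 * a) * z k
  | spin_plus, spin_minus => (z k)^-1
  | _, _ => 0
  end.

Definition weight s : F :=
  \prod_(k : 'I_r)
    ((\prod_(c : 'I_N) weight_delta s k c) * weight_bend s k *
     (\prod_(c : 'I_N) weight_gamma s k c)).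

Definition left_charges s (cs : 'I_r -> int) : bool :=
  [forall k, ((charge_gamma s k ord_max)%:Z == cs k %[mod n])%Z].

End Weights.
End Ice.

(** The number of columns is lambda_1 + r. *)
Definition partition_function (F : fieldType) (n r : nat) (v : F) (g : int -> F)
    (lam : r.-tuple nat) (z : 'I_r -> F) (cs : 'I_r -> int) : F :=
  \sum_(s : state r (head 0%N lam + r) |
          admissible lam s && left_charges n s cs)
    weight n v g z s.

(* Main.v *)
Require Import Defs.
From mathcomp Require Import all_boot all_order all_algebra.
From mathcomp Require Import perm complex reals ring zify.

Set Implicit Arguments.
Unset Strict Implicit.
Unset Printing Implicit Defensive.

Import Order.TTheory GRing.Theory Num.Theory.
Local Open Scope ring_scope.

(** A state of an edge is recorded by its spin and its charge modulo n; in a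
    state of nonzero weight the charge of a + edge of a row i, or of a - edge of
    a row i-bar, is 0. With edges decorated in this way the weight of a vertex
    depends only on its adjacent edges, and the train argument applies to the
    four rows i, i-bar, j, j-bar. The Yang-Baxter equation first exchanges the
    rows i-bar and j, which puts the rows in the order i, j, i-bar, j-bar; the
    pair of bends becomes a vector Psi(z_i, z_j). Then it exchanges i with j,
    and i-bar with j-bar. The caduceus relation says that exchanging i and j in
    Psi(z_i, z_j) amounts to exchanging j-bar and i-bar in Psi(z_j, z_i). On the
    left boundary the first two crossings act by scalars, and the crossing of
    the two rows i-bar and j-bar either keeps or exchanges the charges c_i and
    c_j: this gives the three terms of the functional equation. The scalar
    1 - v (z_i z_j)^n of the first crossing may vanish, but both sides of the
    equation are Laurent polynomials in z_i, so it can be cancelled. *)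

(** * Residues modulo n and powers with residue exponents *)

(* Locked, so that unification does not compute in 'I_m.+1. *)
Definition residue_one (m : nat) : 'I_m.+1 := locked (inZp 1).

(* The representative of x in [1, n], where n = m.+1. *)
Definition rho (m : nat) (x : 'I_m.+1) : nat := if x == 0 then m.+1 else x.

Section Residues.
Variable m : nat.
Implicit Types x y : 'I_m.+1.
Local Notation u := (residue_one m).

Lemma rho0 : rho (0 : 'I_m.+1) = m.+1.
Proof. by rewrite /rho eqxx. Qed.

Lemma rho_gt0 x : (0 < rho x)%N.
Proof. by rewrite /rho; case: (eqVneq x 0) => // x0; rewrite lt0n. Qed.

Lemma rho_le x : (rho x <= m.+1)%N.
Proof. by rewrite /rho; case: eqP => // _; apply/ltnW/ltn_ord. Qed.

Lemma rho_lt x : x != 0 -> (rho x < m.+1)%N.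
Proof. by rewrite /rho => /negPf->; apply/ltn_ord. Qed.

(** Representatives in [1, n] wrap around only from n to 1, that is, at the residue 0. *)
Lemma rhoD1 x : rho (x + u) = if x == 0 then 1%N else (rho x).+1.
Proof.
have val_xu : nat_of_ord (x + u) = ((x + 1) %% m.+1)%N.
  by rewrite /residue_one -lock; exact: modnDmr.
have xuE : (x + u == 0) = ((x + 1) %% m.+1 == 0)%N by rewrite -val_xu.
rewrite /rho xuE val_xu; case: (eqVneq x 0) => [->|x0].
  by rewrite add0n; case: (m) => // k; rewrite modn_small.
have := ltn_ord x; rewrite leq_eqVlt => /orP[/eqP h|h].
  by rewrite addn1 h modnn.
by rewrite addn1 modn_small.
Qed.

Lemma rhoN x : x != 0 -> rho (- x) = (m.+1 - rho x)%N.
Proof.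
move=> x0; rewrite /rho oppr_eq0 (negPf x0) /= modn_small //.
by rewrite ltn_subrL lt0n x0.
Qed.

(** Modulo an odd n the number 2 is invertible. Oddness of n enters the whole argument through this
    fact alone. *)
Lemma residue_double_eq0 x : odd m.+1 -> (x + x == 0) = (x == 0).
Proof.
move=> n_odd; apply/eqP/eqP => [|->]; last exact: addr0.
move/(congr1 val) => /= xx0; apply: val_inj => /=.
have: (m.+1 %| x + x)%N by apply/eqP.
rewrite addnn -mul2n Gauss_dvdr; last by rewrite coprimen2.
by move/eqP; rewrite modn_small.
Qed.

Lemma rho1 : rho u = 1%N.
Proof. by rewrite -(add0r u) rhoD1 eqxx. Qed.

Section Powers.
Variables (F : fieldType) (v : F).
Implicit Types z : F.

(* The factor 1 - v times z1^(-x) z2^x, made homogeneous of degree n. *)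
Definition mono z1 z2 x : F := (1 - v) * z1 ^+ (m.+1 - rho x) * z2 ^+ rho x.

Lemma mono0 z1 z2 : mono z1 z2 0 = (1 - v) * z2 ^+ m.+1.
Proof. by rewrite /mono rho0 subnn mulr1. Qed.

Lemma mono1 z1 z2 : mono z1 z2 u = (1 - v) * z1 ^+ m * z2.
Proof. by rewrite -(add0r u) /mono rhoD1 eqxx subSS subn0 expr1. Qed.

(** Adding 1 to a nonzero residue causes no wrap-around, so it trades one factor [z1] for [z2]. The
    common cofactor [a] lets [ring] treat symbolic exponents in the Yang-Baxter equation. *)
Lemma monoD1_neq0 z1 z2 x : x != 0 ->
  exists a, mono z1 z2 x = a * z1 /\ mono z1 z2 (x + u) = a * z2.
Proof.
move=> x0; exists ((1 - v) * z1 ^+ (m.+1 - (rho x).+1) * z2 ^+ rho x).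
rewrite /mono rhoD1 (negPf x0) exprS -(subnSK (rho_lt x0)) exprS; split; ring.
Qed.

(** Negation sends the representative of a nonzero residue from k to n - k, but the residue 0 keeps
    the representative n; hence the correction term. *)
Lemma monoN z1 z2 x :
  mono z2 z1 x = mono z1 z2 (- x)
    + (x == 0)%:R * ((1 - v) * (z1 ^+ m.+1 - z2 ^+ m.+1)).
Proof.
case: (eqVneq x 0) => [->|x0]; first by rewrite oppr0 !mono0 mulr1n; ring.
rewrite /mono rhoN // subKn ?rho_le // mulr0n; ring.
Qed.

(* The power z^(y - x) with exponent in [0, n - 1], at the cost of a factor v
   when the exponent has to be increased by n. *)
Definition wrap z x y : F :=
  if (rho x <= rho y)%N then z ^+ (rho y - rho x)
  else v * z ^+ (m.+1 + rho y - rho x).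

Lemma wrap_to0 z x : wrap z x 0 = z ^+ (m.+1 - rho x).
Proof. by rewrite /wrap rho0 rho_le. Qed.

Lemma wrap_from0 z y : wrap z 0 y = if y == 0 then 1 else v * z ^+ rho y.
Proof.
rewrite /wrap rho0; case: (eqVneq y 0) => [->|y0]; first by rewrite rho0 leqnn subnn.
by rewrite leqNgt rho_lt //= addnC addnK.
Qed.

Lemma wrap_from1 z y : wrap z u y = z ^+ (rho y).-1.
Proof. by rewrite /wrap rho1 rho_gt0 subn1. Qed.

Lemma wrapD1 z x y :
  wrap z (x + u) (y + u) =
  if x == 0 then (if y == 0 then 1 else z ^+ rho y)
  else if y == 0 then v * z ^+ (m.+1 - rho x) else wrap z x y.
Proof.
rewrite /wrap !rhoD1; case: (eqVneq x 0) => [x0|x0]; case: (eqVneq y 0) => [y0|y0] //=.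
- by rewrite subn1.
- by rewrite ltnNge rho_gt0 /= addn1 subSS.
- by rewrite ltnS addnS !subSS.
Qed.

(** For nonzero residues both exponents are n - [rho x] - [rho y], increased by n in the same cases.
    The factors [v] compensate for the residue 0, which is represented by n. *)
Lemma wrap_sym z x y :
  wrap z x (- y) * (if y == 0 then v else 1)
  = wrap z y (- x) * (if x == 0 then v else 1).
Proof.
case: (eqVneq x 0) => [->|x0]; case: (eqVneq y 0) => [->|y0] //.
- by rewrite wrap_from0 oppr_eq0 (negPf y0) oppr0 wrap_to0 rhoN // mulr1 mulrC.
- by rewrite wrap_from0 oppr_eq0 (negPf x0) oppr0 wrap_to0 rhoN // mulr1 mulrC.
have := rho_lt x0; have := rho_lt y0; rewrite !mulr1 /wrap !rhoN // => hy hx.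
have -> : (rho y <= m.+1 - rho x)%N = (rho x <= m.+1 - rho y)%N by lia.
case: ifP => _; first by congr (_ ^+ _); lia.
by congr (_ * _ ^+ _); lia.
Qed.

End Powers.
End Residues.

Lemma big_option (R : Type) (idx : R) (op : Monoid.com_law idx) (I : finType) (f : option I -> R) :
  \big[op/idx]_(x : option I) f x = op (f None) (\big[op/idx]_(x : I) f (Some x)).
Proof.
rewrite (bigD1 None) //=; congr (op _ _).
rewrite (reindex_omap Some id) => [|[x|]] //=.
by apply: eq_bigl => x; rewrite eqxx.
Qed.

(** * Columns of decorated edges and the Yang-Baxter equation *)

(* The weight of a vertex as a function of the spins of its top and bottom edges
   and of the decorations of its left and right edges. *)
Definition kernel (F : fieldType) (S : finType) := bool -> bool -> S -> S -> F.

Section Stack.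
Variable F : fieldType.

Definition stack (S T : finType) (A : kernel F S) (B : kernel F T) : kernel F (S * T)%type :=
  fun t b X Y => \sum_(s : bool) A t s X.1 Y.1 * B s b X.2 Y.2.

(** The Yang-Baxter equation in operator form: the crossing [R] passes through a column from its
    left to its right, turning the weights [A] into [B]. *)
Definition intertwines (S T : finType) (R : S -> T -> F) (A : kernel F T) (B : kernel F S) :=
  forall t b x y, \sum_x' R x x' * A t b x' y = \sum_y' B t b x y' * R y' y.

(* The vertex weights are sparse; an explicit form of their action on functions
   eliminates the sums in the Yang-Baxter equation. *)
Definition has_left_action (S : finType) (A : kernel F S) (act : bool -> bool -> S -> (S -> F) -> F) :=
  forall t b y R, \sum_x R x * A t b x y = act t b y R.
Definition has_right_action (S : finType) (A : kernel F S) (act : bool -> bool -> S -> (S -> F) -> F) :=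
  forall t b x R, \sum_y A t b x y * R y = act t b x R.

Lemma stack_left_action (S T : finType) (A : kernel F S) (B : kernel F T) actA actB :
  has_left_action A actA -> has_left_action B actB ->
  has_left_action (stack A B) (fun t b y R =>
    \sum_(s : bool) actA t s y.1 (fun x1 => actB s b y.2 (fun x2 => R (x1, x2)))).
Proof.
move=> hA hB t b [y1 y2] R; rewrite /stack.
transitivity (\sum_x1 \sum_x2 R (x1, x2) * \sum_(s : bool) A t s x1 y1 * B s b x2 y2).
  by rewrite pair_bigA; apply: eq_bigr => -[].
under eq_bigr do under eq_bigr do rewrite mulr_sumr.
under eq_bigr do rewrite exchange_big /=.
rewrite exchange_big; apply: eq_bigr => s _ /=; rewrite -hA; apply: eq_bigr => x1 _.
rewrite -hB mulr_suml; apply: eq_bigr => x2 _; ring.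
Qed.

Lemma stack_right_action (S T : finType) (A : kernel F S) (B : kernel F T) actA actB :
  has_right_action A actA -> has_right_action B actB ->
  has_right_action (stack A B) (fun t b x R =>
    \sum_(s : bool) actA t s x.1 (fun y1 => actB s b x.2 (fun y2 => R (y1, y2)))).
Proof.
move=> hA hB t b [x1 x2] R; rewrite /stack.
transitivity (\sum_y1 \sum_y2 (\sum_(s : bool) A t s x1 y1 * B s b x2 y2) * R (y1, y2)).
  by rewrite pair_bigA; apply: eq_bigr => -[].
under eq_bigr do under eq_bigr do rewrite mulr_suml.
under eq_bigr do rewrite exchange_big /=.
rewrite exchange_big; apply: eq_bigr => s _ /=; rewrite -hA; apply: eq_bigr => y1 _.
rewrite -hB mulr_sumr; apply: eq_bigr => y2 _; ring.
Qed.

End Stack.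

(** * Vertex weights on decorated edges, and the crossing of two Delta rows *)

Section VertexKernels.
Variables (F : fieldType) (m : nat) (v : F) (g : 'I_m.+1 -> F).
Local Notation st := (option 'I_m.+1).
Local Notation u := (residue_one m).

(* In Delta ice None is a + edge (of charge 0) and Some a is a - edge of charge
   a; in Gamma ice None is a - edge (of charge 0) and Some a is a + edge of
   charge a. *)
Definition deltaK z : kernel F st := fun t b x y =>
  match x, y with
  | None, None => (t == b)%:R
  | Some x, Some y => (t == b)%:R * ((y == x + u)%:R * (z * (if t then g x else 1)))
  | Some x, None => (~~ t && b)%:R * ((x == 0)%:R * ((1 - v) * z))
  | None, Some y => (t && ~~ b)%:R * (y == u)%:R
  end.

Definition gammaK z : kernel F st := fun t b x y =>
  match x, y with
  | None, None => (t == b)%:R * z^-1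
  | Some x, Some y => (t == b)%:R * ((x == y + u)%:R * (if t then g y else 1))
  | None, Some y => (~~ t && b)%:R * ((y == 0)%:R * ((1 - v) * z^-1))
  | Some x, None => (t && ~~ b)%:R * (x == u)%:R
  end.

Definition deltaK_left z t b (y : st) (R : st -> F) :=
  match y with
  | None => if t == b then R None else if b then R (Some 0) * ((1 - v) * z) else 0
  | Some y => if t == b then R (Some (y - u)) * (z * (if t then g (y - u) else 1))
              else if b then 0 else (y == u)%:R * R None
  end.

Definition deltaK_right z t b (x : st) (R : st -> F) :=
  match x with
  | None => if t == b then R None else if b then 0 else R (Some u)
  | Some x => if t == b then R (Some (x + u)) * (z * (if t then g x else 1))
              else if b then (x == 0)%:R * ((1 - v) * z * R None) else 0
  end.

Definition gammaK_left z t b (y : st) (R : st -> F) :=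
  match y with
  | None => if t == b then z^-1 * R None else if b then 0 else R (Some u)
  | Some y => if t == b then R (Some (y + u)) * (if t then g y else 1)
              else if b then (y == 0)%:R * ((1 - v) * z^-1 * R None) else 0
  end.

Definition gammaK_right z t b (x : st) (R : st -> F) :=
  match x with
  | None => if t == b then z^-1 * R None else if b then R (Some 0) * ((1 - v) * z^-1) else 0
  | Some x => if t == b then R (Some (x - u)) * (if t then g (x - u) else 1)
              else if b then 0 else (x == u)%:R * R None
  end.

Lemma sum_delta (x : 'I_m.+1) (f : 'I_m.+1 -> F) : \sum_y (y == x)%:R * f y = f x.
Proof.
rewrite (bigD1 x) //= eqxx mul1r big1 ?addr0 // => y /negPf->; exact: mul0r.
Qed.

Lemma deltaK_leftP z : has_left_action (deltaK z) (deltaK_left z).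
Proof.
move=> t b [w|] R; rewrite big_option /=; last first.
  rewrite (eq_bigr (fun x => (x == 0)%:R * ((~~ t && b)%:R * (R (Some x) * ((1 - v) * z))))) => [|x _];
    last by ring.
  by rewrite sum_delta; case: t b => [] [] /=; ring.
rewrite (eq_bigr (fun x => (x == w - u)%:R * ((t == b)%:R * (R (Some x) * (z * (if t then g x else 1)))))) => [|x _];
  last by rewrite -subr_eq [w - u == x]eq_sym; ring.
by rewrite sum_delta; case: t b => [] [] /=; ring.
Qed.

Lemma deltaK_rightP z : has_right_action (deltaK z) (deltaK_right z).
Proof.
move=> t b [w|] R; rewrite big_option /=; last first.
  rewrite (eq_bigr (fun x => (x == u)%:R * ((t && ~~ b)%:R * R (Some x)))) => [|x _]; last by ring.
  by rewrite sum_delta; case: t b => [] [] /=; ring.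
rewrite (eq_bigr (fun x => (x == w + u)%:R * ((t == b)%:R * (z * (if t then g w else 1) * R (Some x))))) => [|x _];
    last by ring.
by rewrite sum_delta; case: t b => [] [] /=; ring.
Qed.

Lemma gammaK_leftP z : has_left_action (gammaK z) (gammaK_left z).
Proof.
move=> t b [w|] R; rewrite big_option /=; last first.
  rewrite (eq_bigr (fun x => (x == u)%:R * ((t && ~~ b)%:R * R (Some x)))) => [|x _]; last by ring.
  by rewrite sum_delta; case: t b => [] [] /=; ring.
rewrite (eq_bigr (fun x => (x == w + u)%:R * ((t == b)%:R * (R (Some x) * (if t then g w else 1))))) => [|x _];
    last by ring.
by rewrite sum_delta; case: t b => [] [] /=; ring.
Qed.

Lemma gammaK_rightP z : has_right_action (gammaK z) (gammaK_right z).
Proof.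
move=> t b [w|] R; rewrite big_option /=; last first.
  rewrite (eq_bigr (fun x => (x == 0)%:R * ((~~ t && b)%:R * (R (Some x) * ((1 - v) * z^-1))))) => [|x _];
    last by ring.
  by rewrite sum_delta; case: t b => [] [] /=; ring.
rewrite (eq_bigr (fun x => (x == w - u)%:R * ((t == b)%:R * (R (Some x) * (if t then g x else 1))))) => [|x _];
  last by rewrite -subr_eq [w - u == x]eq_sym; ring.
by rewrite sum_delta; case: t b => [] [] /=; ring.
Qed.

(** Substituting x + 1 for a residue removes the subtractions of [u] produced by the explicit
    actions. *)
Lemma residue_shift (P : 'I_m.+1 -> Prop) : (forall x, P (x + u)) -> forall x, P x.
Proof. by move=> Pu x; rewrite -(subrK u x). Qed.

(* The formulas for deltaR and mixedR come from solving the linear system of the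
   Yang-Baxter equation for n = 1 and n = 3, where the solution is unique up to
   a scalar. *)
Definition deltaR z1 z2 (X Y : st * st) : F :=
  let D := z1 ^+ m.+1 - z2 ^+ m.+1 in
  match X, Y with
  | (None, None), (None, None) => z1 ^+ m.+1 - v * z2 ^+ m.+1
  | (None, Some b), (None, Some d) => (d == b)%:R * mono v z2 z1 (u - b)
  | (None, Some b), (Some c, None) => (c == b)%:R * D
  | (Some a, None), (Some c, None) => (c == a)%:R * mono v z1 z2 (u - a)
  | (Some a, None), (None, Some d) => (d == a)%:R * (v * D)
  | (Some a, Some b), (Some c, Some d) =>
      ((c == a) && (d == b))%:R * mono v z1 z2 (b - a)
      + ((c == b) && (d == a))%:R * (g (b - a) * D)
  | _, _ => 0
  end.

Lemma addr_eqr (x y : 'I_m.+1) : (x + y == y) = (x == 0).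
Proof. by rewrite -subr_eq0 addrK. Qed.

Lemma subDrr (x y : 'I_m.+1) : y - (x + y) = - x.
Proof. by rewrite opprD addrC subrK. Qed.

Lemma addrDB (x y z : 'I_m.+1) : x + z - (y + z) = x - y.
Proof. by rewrite opprD addrACA subrr addr0. Qed.

End VertexKernels.

(** * The Yang-Baxter equation for two Delta rows *)

Section DeltaDelta.
Variables (F : fieldType) (m : nat) (v : F) (g : 'I_m.+1 -> F).
Local Notation u := (residue_one m).
Hypothesis g0 : g 0 = - v.
Hypothesis gN : forall x : 'I_m.+1, x != 0 -> g x * g (- x) = v.

Lemma deltaR_intertwines z1 z2 :
  intertwines (deltaR v g z1 z2) (stack (deltaK v g z1) (deltaK v g z2))
    (stack (deltaK v g z2) (deltaK v g z1)).
Proof.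
move=> t b X Y.
rewrite (stack_left_action (deltaK_leftP v g z1) (deltaK_leftP v g z2)).
rewrite (stack_right_action (deltaK_rightP v g z2) (deltaK_rightP v g z1)).
case: X Y => [[x1|] [x2|]] [[y1|] [y2|]]; rewrite !big_bool;
  case: t b => [] [] /=; rewrite ?(mul0r, mulr0, addr0, add0r) //.
all: try (elim/residue_shift: y1 => y1).
all: try (elim/residue_shift: y2 => y2).
all: rewrite ?(addrK, inj_eq (addIr u), addr_eqr, subDrr, addrDB, subrr, mono0) ?[0 == _]eq_sym.
all: rewrite ?[u - _]addrC.
(* Deciding every equality between residues leaves identities in the [mono] terms, [g] and
   powers. *)
all: repeat (match goal with
  | |- context [?a == ?b] => let E := fresh "E" in case: (eqVneq a b) => E; [try subst | ] => /=
  end; rewrite ?(mul0r, mulr0, add0r, addr0, subr0, oppr0, oppr_eq0, eqr_opp, eqxx) //).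
all: rewrite ?(mul1r, mulr1, add0r, subrr,oppr0,mono0,mono1,g0) //.
all: try match goal with E : is_true (?x != 0) |- _ =>
  have nE : - x != 0 by rewrite oppr_eq0 end.
(* The [mono] terms at -x and -x + 1 share a cofactor, and v is expanded as [g x * g (- x)]. *)
all: try match goal with E : is_true (?x != 0), nE : is_true (- ?x != 0) |- _ =>
  have [a [Ha Hb]] := monoD1_neq0 v z1 z2 nE;
  have [a' [Ha' Hb']] := monoD1_neq0 v z2 z1 nE;
  have Hc := monoN v z2 z1 x; rewrite (negPf E) mul0r addr0 in Hc;
  by rewrite ?Hc ?Ha ?Hb ?Ha' ?Hb' -?(gN E); ring end.
all: by rewrite ?exprS; ring.
Qed.
End DeltaDelta.

(** * The Yang-Baxter equation for a Gamma row above a Delta row *)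

Section Mixed.
Variables (F : fieldType) (m : nat) (v : F) (g : 'I_m.+1 -> F).
Local Notation st := (option 'I_m.+1).
Local Notation u := (residue_one m).

(** [X] decorates the left side of the crossing, where the Delta row is on top, and [Y] the right
    side, where the Gamma row is on top. *)
Definition mixedR z1 z2 (X Y : st * st) : F :=
  let w := z1 * z2 in
  match X, Y with
  | (None, None), (None, None) => 1 - w ^+ m.+1
  | (None, None), (Some a, Some b) => (a + b == u)%:R * ((1 - v) * w ^+ (rho b).-1)
  | (None, Some y), (Some a, None) => (a == y)%:R * (1 - v * w ^+ m.+1)
  | (Some x, None), (None, Some b) => (b == x)%:R * (1 - v * w ^+ m.+1)
  | (Some x, Some y), (None, None) => (x + y == u)%:R * ((1 - v) * w ^+ rho y)
  | (Some x, Some y), (Some a, Some b) =>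
      ((a == y) && (b == x))%:R * (g (x + y - u) * (1 - v * w ^+ m.+1))
      - ((x + y == u) && (a + b == u))%:R * ((1 - v) * wrap v w x b)
  | _, _ => 0
  end.

Hypothesis g0 : g 0 = - v.
Hypothesis gN : forall x : 'I_m.+1, x != 0 -> g x * g (- x) = v.

Lemma mixedR_intertwines z1 z2 : z1 != 0 ->
  intertwines (mixedR z1 z2) (stack (gammaK v g z1) (deltaK v g z2))
     (stack (deltaK v g z2) (gammaK v g z1)).
Proof.
move=> z1_neq0 t b X Y.
rewrite (stack_left_action (gammaK_leftP v g z1) (deltaK_leftP v g z2)).
rewrite (stack_right_action (deltaK_rightP v g z2) (gammaK_rightP v g z1)).
have addrCK (x y : 'I_m.+1) : y + x - y = x by rewrite addrC addKr.
have addr_eql (x y : 'I_m.+1) : (y + x == y) = (x == 0) by rewrite addrC addr_eqr.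
have opp_ind (P : 'I_m.+1 -> Prop) : (forall x, P (- x)) -> forall x, P x.
  by move=> PN x; rewrite -(opprK x).
have wrap00 w : wrap v w (0 : 'I_m.+1) 0 = 1 by rewrite wrap_to0 rho0 subnn.
have wrap0 w (x : 'I_m.+1) : x != 0 -> wrap v w 0 x = v * w ^+ rho x.
  by move=> x0; rewrite wrap_from0 (negPf x0).
case: X Y => [[x|] [y|]] [[a|] [b'|]]; rewrite !big_bool;
  case: t b => [] [] /=; rewrite ?(mul0r, mulr0, addr0, add0r) //.
(* The substitution of 1 - y for y turns the condition x + y = 1 of the crossing into x = y. *)
all: try (elim/residue_shift: y => y; elim/opp_ind: y => y).
all: try (elim/residue_shift: b' => b').
all: try (elim/opp_ind: a => a).
all: rewrite ?addrCK ?(addrK,subrK).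
all: rewrite  ?(addrA,  addrAC _ u).
all: rewrite ?addrCK ?(subrK, addrK, inj_eq (addIr u), addr_eqr, addr_eql, subrr, eqxx).
all: rewrite ?[0 == _]eq_sym.
all: rewrite ?[u == _ + u]eq_sym.
all: rewrite ?addr_eqr ?(addr_eq0, opprK, eqr_opp, oppr_eq0).
all: rewrite ?wrap_to0 ?wrap_from1 ?wrapD1 ?rhoD1 ?rho0 ?oppr_eq0.
all: repeat (match goal with
  | |- context [?a == ?b] => let E := fresh "E" in case: (eqVneq a b) => E; [try subst | ] => /=
  end; rewrite ?(mul0r, mulr0, add0r, addr0, subr0, oppr0, oppr_eq0, eqr_opp, eqxx) //).
all: rewrite ?(subrr,subnn,wrap00,oppr0,g0,rho0,expr0,sub0r,mul1r,mulr1,expr1) //.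
(* The two sides expand v differently, as [g y * g (- y)] and as [g x * g (- x)]. Abstracting [wrap]
   and 1 - v protects their own occurrences of v from the rewriting. *)
all: try match goal with E : is_true (?x != 0), E' : is_true (?y != 0) |- context [wrap _ _ ?x ?y] =>
  move: (wrap _ _ _ _) (1 - v) => W c; transitivity (- (c * W) * (z2 * v));
  [by rewrite -(gN E'); ring | by rewrite -(gN E); ring] end.
all: try match goal with E : is_true (?x != 0) |- _ =>
  by rewrite ?wrap_to0 ?(rhoN E) ?(wrap0 _ _ E) ?(subKn (rho_le x)) -?(gN E) ?exprMn ?exprS; field end.
all: try match goal with E : is_true (?x != 0) |- context [(rho ?x).-1] =>
  by rewrite -?(gN E); case: (rho x) (rho_gt0 x) => // k _ /=; rewrite ?exprMn ?exprS; field end.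
Qed.
End Mixed.

(** * The crossing of two Gamma rows, and the caduceus relation *)

Section Caduceus.
Variables (F : fieldType) (m : nat) (v : F) (g : 'I_m.+1 -> F).
Local Notation st := (option 'I_m.+1).
Local Notation u := (residue_one m).

(* Up to the change of basis gauge, the weights of Gamma ice are the transposes
   of those of Delta ice. *)
Definition gauge (z : F) (x : st) : F := if x is Some _ then z else 1.

Lemma gauge_neq0 z x : z != 0 -> gauge z x != 0.
Proof. by case: x => //= _; rewrite oner_neq0. Qed.

Lemma gammaK_transpose z t b x y : z != 0 ->
  gammaK v g z t b x y = z^-1 * (gauge z x / gauge z y) * deltaK v g z t b y x.
Proof.
by move=> z0; case: x y => [x|] [y|] /=; rewrite ?divr1; field.
Qed.

(** Transposition reverses the order of composition, so this is [deltaR] with its arguments and its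
    parameters exchanged, conjugated by [gauge]. *)
Definition gammaR z1 z2 (X Y : st * st) : F :=
  gauge z2 X.1 * gauge z1 X.2 / (gauge z1 Y.1 * gauge z2 Y.2) * deltaR v g z2 z1 Y X.

Hypothesis g0 : g 0 = - v.
Hypothesis gN : forall x : 'I_m.+1, x != 0 -> g x * g (- x) = v.

(** This is the transposed equation for two Delta rows; the [gauge] factors cancel on the inner
    edges. *)
Lemma gammaR_intertwines z1 z2 : z1 != 0 -> z2 != 0 ->
  intertwines (gammaR z1 z2) (stack (gammaK v g z1) (gammaK v g z2))
    (stack (gammaK v g z2) (gammaK v g z1)).
Proof.
move=> z1_neq0 z2_neq0 t b X Y; have := deltaR_intertwines g0 gN z2 z1 t b Y X.
have stackE w1 w2 X' Y' : w1 != 0 -> w2 != 0 ->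
    stack (gammaK v g w1) (gammaK v g w2) t b X' Y'
    = (w1 * w2)^-1 * (gauge w1 X'.1 * gauge w2 X'.2 / (gauge w1 Y'.1 * gauge w2 Y'.2))
      * stack (deltaK v g w1) (deltaK v g w2) t b Y' X'.
  move=> w1_neq0 w2_neq0; rewrite mulr_sumr; apply: eq_bigr => s _.
  by rewrite !gammaK_transpose //; field; rewrite w1_neq0 w2_neq0 !gauge_neq0.
move=> deltaE; pose c := (z1 * z2)^-1 * (gauge z2 X.1 * gauge z1 X.2) / (gauge z1 Y.1 * gauge z2 Y.2).
transitivity (c * \sum_y' stack (deltaK v g z1) (deltaK v g z2) t b Y y' * deltaR v g z2 z1 y' X).
  rewrite mulr_sumr; apply: eq_bigr => X' _; rewrite stackE // /gammaR /c.
  by field; rewrite z1_neq0 z2_neq0 !gauge_neq0.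
rewrite -deltaE mulr_sumr; apply: eq_bigr => Y' _; rewrite stackE // /gammaR /c.
by field; rewrite z1_neq0 z2_neq0 !gauge_neq0.
Qed.

Lemma sum_delta2 (x y : 'I_m.+1) (f : 'I_m.+1 -> 'I_m.+1 -> F) :
  \sum_a \sum_b ((a == x) && (b == y))%:R * f a b = f x y.
Proof.
rewrite -(sum_delta x (f^~ y)); apply: eq_bigr => a _.
rewrite -(sum_delta y (f a)) mulr_sumr; apply: eq_bigr => b _.
by rewrite -mulnb natrM mulrA.
Qed.

Lemma sum_st2 (f : st * st -> F) :
  \sum_X f X = f (None, None) + \sum_b f (None, Some b)
    + (\sum_a f (Some a, None) + \sum_a \sum_b f (Some a, Some b)).
Proof.
transitivity (\sum_x1 \sum_x2 f (x1, x2)).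
  by rewrite pair_bigA; apply: eq_bigr => -[].
rewrite !big_option /= -big_split /=; congr (_ + _).
by apply: eq_bigr => a _; rewrite big_option.
Qed.

(** One formula serves the rows and the columns of [deltaR]: transposition exchanges the
    off-diagonal coefficients 1 and v and negates the argument of [g]. *)
Definition deltaR_act z1 z2 (c1 c2 : F) (X : st * st) (f : st * st -> F)
    (d : 'I_m.+1 -> 'I_m.+1 -> 'I_m.+1) : F :=
  let D := z1 ^+ m.+1 - z2 ^+ m.+1 in
  match X with
  | (None, None) => (z1 ^+ m.+1 - v * z2 ^+ m.+1) * f (None, None)
  | (None, Some b) => mono v z2 z1 (u - b) * f (None, Some b) + c1 * D * f (Some b, None)
  | (Some a, None) => mono v z1 z2 (u - a) * f (Some a, None) + c2 * D * f (None, Some a)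
  | (Some a, Some b) => mono v z1 z2 (b - a) * f (Some a, Some b)
                        + g (d a b) * D * f (Some b, Some a)
  end.

Lemma sum0 (T : finType) (f : T -> F) : \sum_x 0 * f x = 0.
Proof. by rewrite big1 // => x _; rewrite mul0r. Qed.

Lemma sum_deltaR_row z1 z2 X f :
  \sum_Y deltaR v g z1 z2 X Y * f Y = deltaR_act z1 z2 1 v X f (fun a b => b - a).
Proof.
rewrite sum_st2; case: X => [[a|] [b|]] /=; rewrite ?mul0r.
- rewrite !sum0 !add0r.
  rewrite -(sum_delta2 a b (fun x y => mono v z1 z2 (b - a) * f (Some x, Some y))).
  rewrite -(sum_delta2 b a (fun x y => g (b - a) * (z1 ^+ m.+1 - z2 ^+ m.+1) * f (Some x, Some y))).
  rewrite -big_split; apply: eq_bigr => x _; rewrite -big_split; apply: eq_bigr => y _ /=; ring.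
- rewrite -(sum_delta a (fun x => v * (z1 ^+ m.+1 - z2 ^+ m.+1) * f (None, Some x))).
  rewrite -(sum_delta a (fun x => mono v z1 z2 (u - a) * f (Some x, None))).
  rewrite [X in _ + (_ + X)]big1 => [|x _]; last exact: sum0.
  rewrite add0r addr0 addrC; congr (_ + _); apply: eq_bigr => x _; ring.
- rewrite -(sum_delta b (fun x => mono v z2 z1 (u - b) * f (None, Some x))).
  rewrite -(sum_delta b (fun x => 1 * (z1 ^+ m.+1 - z2 ^+ m.+1) * f (Some x, None))).
  rewrite [X in _ + (_ + X)]big1 => [|x _]; last exact: sum0.
  rewrite add0r addr0; congr (_ + _); apply: eq_bigr => x _; ring.
- rewrite [X in _ + (_ + X)]big1 => [|x _]; last exact: sum0.
  by rewrite !sum0 !addr0.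
Qed.

Lemma sum_deltaR_col z1 z2 Y f :
  \sum_X deltaR v g z1 z2 X Y * f X = deltaR_act z1 z2 v 1 Y f (fun a b => a - b).
Proof.
rewrite sum_st2; case: Y => [[a|] [b|]] /=; rewrite ?mul0r.
- rewrite !sum0 !add0r.
  rewrite -(sum_delta2 a b (fun x y => mono v z1 z2 (b - a) * f (Some x, Some y))).
  rewrite -(sum_delta2 b a (fun x y => g (a - b) * (z1 ^+ m.+1 - z2 ^+ m.+1) * f (Some x, Some y))).
  rewrite -big_split; apply: eq_bigr => x _; rewrite -big_split; apply: eq_bigr => y _ /=.
  rewrite ![a == _]eq_sym ![b == _]eq_sym.
  rewrite mulrDl -!mulrA; congr (_ + _); first by case: andP => [[/eqP-> /eqP->]|_]; rewrite ?mul0r.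
  by rewrite andbC; case: andP => [[/eqP-> /eqP->]|_]; rewrite ?mul0r.
- rewrite -(sum_delta a (fun x => 1 * (z1 ^+ m.+1 - z2 ^+ m.+1) * f (None, Some x))).
  rewrite -(sum_delta a (fun x => mono v z1 z2 (u - a) * f (Some x, None))).
  rewrite [X in _ + (_ + X)]big1 => [|x _]; last exact: sum0.
  rewrite add0r addr0 addrC; congr (_ + _); apply: eq_bigr => x _;
    rewrite [a == _]eq_sym; case: (eqVneq x a) => [->|_] /=; ring.
- rewrite -(sum_delta b (fun x => mono v z2 z1 (u - b) * f (None, Some x))).
  rewrite -(sum_delta b (fun x => v * (z1 ^+ m.+1 - z2 ^+ m.+1) * f (Some x, None))).
  rewrite [X in _ + (_ + X)]big1 => [|x _]; last exact: sum0.
  rewrite add0r addr0; congr (_ + _); apply: eq_bigr => x _;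
    rewrite [b == _]eq_sym; case: (eqVneq x b) => [->|_] /=; ring.
- rewrite [X in _ + (_ + X)]big1 => [|x _]; last exact: sum0.
  by rewrite !sum0 !addr0.
Qed.

(** With [d = u] this is the passage around a bend: a - edge of charge a in the Delta row faces a +
    edge of charge a + 1 in the Gamma row, since that edge counts itself. *)
Definition shift (d : 'I_m.+1) : st -> st := omap (fun a => a + d).

Definition bend z (x : st) : F := if x is Some a then g (a + a) * z else z^-1.

(* The vector Psi(z1, z2): X decorates the right edges of the rows i and j, and Y
   those of the rows i-bar and j-bar. *)
Definition bend_pair z1 z2 (X Y : st * st) : F :=
  mixedR v g z1 z2 (X.2, Y.1) (shift u X.1, shift (- u) Y.2)
  * bend z1 X.1 * bend z2 (shift (- u) Y.2).

Hypothesis n_odd : odd m.+1.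

Lemma double_inv (x : 'I_m.+1) : x != 0 -> g (x + x) * g (- x - x) = v.
Proof. by move=> x0; rewrite -opprD gN // residue_double_eq0. Qed.

(** Since [gammaR] is a transposed [deltaR], the right-hand side is a column sum of [deltaR]. Both
    sides then have at most two terms in each of the sixteen cases of decorations. *)
Lemma caduceus z1 z2 X Y : z1 != 0 -> z2 != 0 ->
  \sum_X' deltaR v g z1 z2 X X' * bend_pair z1 z2 X' Y
  = \sum_Y' gammaR z2 z1 Y Y' * bend_pair z2 z1 X Y'.
Proof.
move=> z1_neq0 z2_neq0.
rewrite sum_deltaR_row.
transitivity (\sum_Y' deltaR v g z1 z2 Y' Y *
  (gauge z1 Y.1 * gauge z2 Y.2 / (gauge z2 Y'.1 * gauge z1 Y'.2) * bend_pair z2 z1 X Y')); last first.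
  by apply: eq_bigr => Y' _; rewrite /gammaR; ring.
rewrite sum_deltaR_col.
rewrite /bend_pair; case: X Y => [[x1|] [x2|]] [[y1|] [y2|]] /=;
  rewrite ?(mul0r, mulr0, add0r, addr0) ?[z2 * z1]mulrC //.
all: try (elim/residue_shift: y1 => y1).
all: try (elim/residue_shift: y2 => y2).
all: rewrite ?(addrK, inj_eq (addIr u), addr_eqr, subDrr, addrDB, subrr, mono0, addrA) ?[0 == _]eq_sym.
all: rewrite ?[_ + u + _]addrAC ?addr_eqr.
all: rewrite ?[u - _]addrC.
(* All four edges carry charges: the two terms of [deltaR] times the two terms of [mixedR] give four
   products, matched one by one in [h1] to [h4]. *)
- have h1 : ((x1 == y1) && (y2 == x2))%:R * mono v z1 z2 (x2 - x1)
          = ((x1 == y1) && (y2 == x2))%:R * mono v z1 z2 (y2 - y1).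
    by case: andP => [[/eqP-> /eqP->]|_]; rewrite ?mul0r.
  have h2 : ((x2 == y1) && (y2 == x1))%:R * g (x2 - x1) * g (x1 + y1) * g (x2 + x2) * g (y2 + y2)
          = ((x1 == y2) && (y1 == x2))%:R * g (y1 - y2) * g (x2 + y2) * g (x1 + x1) * g (y1 + y1).
    rewrite [x2 == y1]eq_sym [x1 == y2]eq_sym [in RHS]andbC.
    by case: andP => [[/eqP-> /eqP->]|_]; rewrite ?mul0r // [x1 + x2]addrC; ring.
  have h3 : ((x2 + y1 == 0) && (x1 + y2 == 0))%:R * mono v z1 z2 (x2 - x1)
          = ((x2 + y1 == 0) && (x1 + y2 == 0))%:R * mono v z1 z2 (y2 - y1).
    rewrite ![_ + _ == 0]addr_eq0; case: andP => [[/eqP-> /eqP->]|_]; rewrite ?mul0r //.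
    by rewrite opprK addrC.
  have h4 : ((x1 + y1 == 0) && (x2 + y2 == 0))%:R * g (x2 - x1) * wrap v (z1 * z2) x1 y2
            * g (x2 + x2) * g (y2 + y2)
          = ((x2 + y2 == 0) && (x1 + y1 == 0))%:R * g (y1 - y2) * wrap v (z1 * z2) x2 y1
            * g (x1 + x1) * g (y1 + y1).
    rewrite andbC [x1 + y1]addrC [x2 + y2]addrC !addr_eq0.
    case: andP => [[/eqP-> /eqP->]|_]; rewrite ?mul0r //.
    (* At x = 0 the product is v^2, because g(0) = -v; the additional v is exactly the factor in
       [wrap_sym]. *)
    have gE (x : 'I_m.+1) : g (x + x) * g (- x - x) = v * (if x == 0 then v else 1).
      case: (eqVneq x 0) => [->|x0]; last by rewrite double_inv // mulr1.
      by rewrite oppr0 addr0 g0 mulrNN.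
    rewrite !mul1r [- x1 - _]addrC opprK.
    have := wrap_sym v (z1 * z2) x1 x2; have := gE x1; have := gE x2.
    move: (if x1 == 0 then _ else _) (if x2 == 0 then _ else _) => c1 c2 h2' h1' hw.
    transitivity (g (x2 - x1) * v * (wrap v (z1 * z2) x1 (- x2) * c2)).
      by rewrite -[LHS]mulrA h2'; ring.
    by rewrite hw -[RHS]mulrA h1'; ring.
  pose c1 := (1 - v * (z1 * z2) ^+ m.+1) * (g (x1 + x1) * z1) * (g (y2 + y2) * z2) * g (x2 + y1).
  pose c2 := (1 - v * (z1 * z2) ^+ m.+1) * (z1 ^+ m.+1 - z2 ^+ m.+1) * z1 * z2.
  pose c3 := (1 - v) * wrap v (z1 * z2) x2 y2 * g (x1 + x1) * z1 * g (y2 + y2) * z2.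
  pose c4 := (z1 ^+ m.+1 - z2 ^+ m.+1) * (1 - v) * z1 * z2.
  rewrite divff ?mulf_neq0 // mul1r.
  set LHS := (X in X = _); set RHS := (X in _ = X).
  have -> : LHS = ((x1 == y1) && (y2 == x2))%:R * mono v z1 z2 (x2 - x1) * c1
    + ((x2 == y1) && (y2 == x1))%:R * g (x2 - x1) * g (x1 + y1) * g (x2 + x2) * g (y2 + y2) * c2
    - ((x2 + y1 == 0) && (x1 + y2 == 0))%:R * mono v z1 z2 (x2 - x1) * c3
    - ((x1 + y1 == 0) && (x2 + y2 == 0))%:R * g (x2 - x1) * wrap v (z1 * z2) x1 y2
      * g (x2 + x2) * g (y2 + y2) * c4.
    by rewrite /LHS /c1 /c2 /c3 /c4; ring.
  by rewrite h1 h2 h3 h4 /RHS /c1 /c2 /c3 /c4; ring.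
all: have rhoE (x : 'I_m.+1) : x != 0 -> rho (- x + u) = (rho (- x)).-1.+2
  by move=> x0; rewrite rhoD1 oppr_eq0 (negPf x0) prednK // rho_gt0.
all: have addr_eq0r (x y : 'I_m.+1) : (x + y == 0) = (y == - x) by rewrite addrC addr_eq0.
(* No residue has order two, as n is odd. *)
all: have opp_fix (x : 'I_m.+1) : (x == - x) = (x == 0) by rewrite -addr_eq0 residue_double_eq0.
all: try match goal with |- context [mono _ _ _ (- ?x + u)] =>
  rewrite ?[x == _]eq_sym ?addr_eq0r; case: (eqVneq x 0) => [->|x0] end.
all: rewrite ?oppr0.
all: repeat (match goal with
  | |- context [?a == ?b] => let E := fresh "E" in case: (eqVneq a b) => E; [try subst | ] => /=
  end; rewrite ?(mul0r, mulr0, add0r, addr0,subr0,oppr0,opp_fix,eqxx,mul1r,mulr1,divr1) //).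
all: rewrite ?(add0r,addr0,oppr0,mono0,mono1,rhoD1,eqxx,g0,rho0).
all: rewrite ?opprK.
all: try match goal with x0 : is_true (?x != 0), E : - ?x = ?x |- _ =>
  by have := opp_fix x; rewrite E eqxx (negPf x0) end.
all: try match goal with x0 : is_true (?x != 0) |- _ =>
  have nx0 : - x != 0 by rewrite oppr_eq0 end.
all: try match goal with x0 : is_true (?x != 0), nx0 : is_true (- ?x != 0) |- _ =>
  have [a [Ha Hb]] := monoD1_neq0 v z1 z2 nx0;
  have [a' [Ha' Hb']] := monoD1_neq0 v z2 z1 nx0;
  have Hc := monoN v z2 z1 x; have Hc' := monoN v z1 z2 x;
  rewrite (negPf x0) mul0r addr0 in Hc Hc';
  rewrite ?Hc ?Hc' ?Ha ?Hb ?Ha' ?Hb' -?(double_inv x0) ?(negPf nx0);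
  case: (rho (- x)) (rho_gt0 (- x)) => // k _ /= end.
all: rewrite ?rho1 ?exprMn ?exprS.
all: by field; rewrite ?z1_neq0 ?z2_neq0 ?oner_neq0.
Qed.
End Caduceus.

(** * Rows as transfer matrices and the train argument *)

Section FinFunSums.
Variables (V : nmodType) (T : finType).

Definition ffun_cons N (x : T) (f : {ffun 'I_N -> T}) : {ffun 'I_N.+1 -> T} :=
  [ffun i => if unlift ord0 i is Some j then f j else x].

Lemma ffun_cons0 N x (f : {ffun 'I_N -> T}) : ffun_cons x f ord0 = x.
Proof. by rewrite ffunE unlift_none. Qed.

Lemma ffun_consS N x (f : {ffun 'I_N -> T}) i : ffun_cons x f (lift ord0 i) = f i.
Proof. by rewrite ffunE liftK. Qed.

Lemma sum_ffun_cons N (Phi : {ffun 'I_N.+1 -> T} -> V) :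
  \sum_f Phi f = \sum_x \sum_f Phi (ffun_cons x f).
Proof.
rewrite pair_bigA (reindex (fun p => ffun_cons p.1 p.2)) //=.
exists (fun f : {ffun 'I_N.+1 -> T} => (f ord0, [ffun i => f (lift ord0 i)])) => [[x f]|f] _.
  by congr (_, _); [rewrite ffun_cons0 | apply/ffunP => i; rewrite ffunE ffun_consS].
by apply/ffunP => i; rewrite ffunE; case: unliftP => [j|] -> //=; rewrite ffunE.
Qed.

Lemma sum_ffun_ord0 (Phi : {ffun 'I_0 -> T} -> V) (f0 : {ffun 'I_0 -> T}) : \sum_f Phi f = Phi f0.
Proof.
have all_f0 f : f = f0 by apply/ffunP => -[].
by rewrite (bigD1 f0) //= big1 ?addr0 // => f; rewrite (all_f0 f) eqxx.
Qed.

End FinFunSums.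

Section Amplitudes.
Variable F : fieldType.

(** The recursion removes the column [ord0], which is the rightmost one; so [x] decorates the left
    boundary edge and [y] the right one. *)
Fixpoint amplitude (S : finType) (K : kernel F S) N :
    ('I_N -> bool) -> ('I_N -> bool) -> S -> S -> F :=
  if N is N'.+1 then fun t b x y =>
    \sum_z amplitude K (fun i => t (lift ord0 i)) (fun i => b (lift ord0 i)) x z
           * K (t ord0) (b ord0) z y
  else fun _ _ x y => (x == y)%:R.

Lemma eq_amplitude (S : finType) (K : kernel F S) N (t t' b b' : 'I_N -> bool) x y :
  t =1 t' -> b =1 b' -> amplitude K t b x y = amplitude K t' b' x y.
Proof.
elim: N t t' b b' y => [|N IH] t t' b b' y tE bE //=.
by apply: eq_bigr => z _; rewrite tE bE (IH _ (fun i => t' (lift ord0 i)) _ (fun i => b' (lift ord0 i))).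
Qed.

(** The train argument: the crossing moves through the columns one at a time. *)
Lemma amplitude_intertwines (S T : finType) (R : S -> T -> F) (A : kernel F T) (B : kernel F S) N
    (t b : 'I_N -> bool) x y :
  intertwines R A B ->
  \sum_x' R x x' * amplitude A t b x' y = \sum_y' amplitude B t b x y' * R y' y.
Proof.
move=> RAB; elim: N t b y => [|N IH] t b y /=.
  rewrite (bigD1 y) //= eqxx mulr1 big1 ?addr0 => [|z /negPf->]; last exact: mulr0.
  rewrite (bigD1 x) //= eqxx mul1r big1 ?addr0 // => z; rewrite eq_sym => /negPf->; exact: mul0r.
under eq_bigr do rewrite mulr_sumr.
rewrite exchange_big /=; under eq_bigr do under eq_bigr do rewrite mulrA.
under eq_bigr do rewrite -mulr_suml IH mulr_suml.
rewrite exchange_big /=; under eq_bigr do under eq_bigr do rewrite -mulrA.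
under eq_bigr do rewrite -mulr_sumr RAB mulr_sumr.
rewrite exchange_big; apply: eq_bigr => z _ /=; rewrite mulr_suml.
by apply: eq_bigr => w _; rewrite mulrA.
Qed.

Lemma amplitude_stack (S T : finType) (A : kernel F S) (B : kernel F T) N (t b : 'I_N -> bool) X Y :
  amplitude (stack A B) t b X Y
  = \sum_(s : {ffun 'I_N -> bool}) amplitude A t s X.1 Y.1 * amplitude B s b X.2 Y.2.
Proof.
elim: N t b Y => [|N IH] t b Y /=.
  rewrite (sum_ffun_ord0 _ [ffun=> true]) -natrM mulnb.
  by case: X Y => [x1 x2] [y1 y2].
rewrite sum_ffun_cons.
transitivity (\sum_Z1 \sum_Z2 \sum_s0 \sum_(s : {ffun 'I_N -> bool})
   (amplitude A (fun i => t (lift ord0 i)) s X.1 Z1 * A (t ord0) s0 Z1 Y.1)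
   * (amplitude B s (fun i => b (lift ord0 i)) X.2 Z2 * B s0 (b ord0) Z2 Y.2)).
  rewrite pair_bigA; apply: eq_bigr => -[Z1 Z2] _ /=; rewrite IH /stack mulr_sumr.
  apply: eq_bigr => s0 _; rewrite mulr_suml; apply: eq_bigr => s _ /=; ring.
under eq_bigr do rewrite exchange_big /=.
rewrite exchange_big; apply: eq_bigr => s0 _ /=.
under eq_bigr do rewrite exchange_big /=.
rewrite exchange_big; apply: eq_bigr => s _ /=.
rewrite mulr_suml; apply: eq_bigr => Z1 _; rewrite mulr_sumr; apply: eq_bigr => Z2 _.
rewrite ffun_cons0; congr (_ * _ * (_ * _)); apply: eq_amplitude => // i; exact/esym/ffun_consS.
Qed.

End Amplitudes.

(** * The train argument for two adjacent double rows *)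

Section Strip.
Variables (F : fieldType) (m : nat) (v : F) (g : 'I_m.+1 -> F) (N : nat).
Local Notation st := (option 'I_m.+1).
Local Notation u := (residue_one m).
Local Notation cols := {ffun 'I_N -> bool}.
Local Notation deltaA z := (amplitude (deltaK v g z)).
Local Notation gammaA z := (amplitude (gammaK v g z)).
Implicit Types (t b s p : cols) (c : 'I_m.+1).

(** The left boundary spins are +, which means [None] in the Delta row and the prescribed charge in
    the Gamma row. *)
Definition pair_weight z c t s b : F :=
  \sum_x deltaA z t s None x * bend g z x * gammaA z s b (Some c) (shift u x).

Definition strip_weight z1 z2 c1 c2 t b : F :=
  \sum_s1 \sum_p \sum_s2 pair_weight z1 c1 t s1 p * pair_weight z2 c2 p s2 b.

(* The rows are in the order i, j, i-bar, j-bar. *)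
Definition sorted_strip (A B : kernel F (st * st)%type) t b L M (Psi : st * st -> st * st -> F) : F :=
  \sum_(p : cols) \sum_X \sum_Y amplitude A t p L X * amplitude B p b M Y * Psi X Y.

Hypothesis g0 : g 0 = - v.
Hypothesis gN : forall x : 'I_m.+1, x != 0 -> g x * g (- x) = v.

Lemma shiftK : cancel (shift u) (shift (- u) : st -> st).
Proof. by case=> //= x; rewrite addrK. Qed.

Lemma shiftNK : cancel (shift (- u)) (shift u : st -> st).
Proof. by case=> //= x; rewrite subrK. Qed.

(** At the left boundary, where both spins are +, the crossing has a single nonzero entry and acts
    as a scalar. *)
Lemma sum_mixedR_row z1 z2 c f :
  \sum_Y mixedR v g z1 z2 (None, Some c) Y * f Y = (1 - v * (z1 * z2) ^+ m.+1) * f (Some c, None).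
Proof.
rewrite sum_st2 /= !sum0 mul0r !add0r [X in _ + X]big1 => [|x _]; last exact: sum0.
rewrite addr0 -(sum_delta c (fun x => (1 - v * (z1 * z2) ^+ m.+1) * f (Some x, None))).
by apply: eq_bigr => x _; rewrite mulrA.
Qed.

(** The scalar stands for a crossing of the rows i-bar and j at the left boundary; it travels to the
    bends and is absorbed in [bend_pair]. *)
Lemma strip_sort z1 z2 c1 c2 t b : z1 != 0 ->
  (1 - v * (z1 * z2) ^+ m.+1) * strip_weight z1 z2 c1 c2 t b
  = sorted_strip (stack (deltaK v g z1) (deltaK v g z2)) (stack (gammaK v g z1) (gammaK v g z2))
      t b (None, None) (Some c1, Some c2) (bend_pair v g z1 z2).
Proof.
move=> z1_neq0.
(* [outer] gathers what the crossing does not touch: the rows i and j-bar and the two bends. *)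
pose outer s1 s2 x1 x2 := deltaA z1 t s1 None x1 * bend g z1 x1 * bend g z2 x2
                          * gammaA z2 s2 b (Some c2) (shift u x2).
transitivity (\sum_(s1 : cols) \sum_(s2 : cols) \sum_x1 \sum_x2 outer s1 s2 x1 x2 *
  \sum_Y mixedR v g z1 z2 (None, Some c1) Y *
    amplitude (stack (gammaK v g z1) (deltaK v g z2)) s1 s2 Y (shift u x1, x2)).
  rewrite mulr_sumr; apply: eq_bigr => s1 _; rewrite exchange_big mulr_sumr; apply: eq_bigr => s2 _ /=.
  transitivity (\sum_x1 \sum_x2 outer s1 s2 x1 x2 * ((1 - v * (z1 * z2) ^+ m.+1) *
    \sum_(p : cols) gammaA z1 s1 p (Some c1) (shift u x1) * deltaA z2 p s2 None x2)); last first.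
    by apply: eq_bigr => x1 _; apply: eq_bigr => x2 _; rewrite sum_mixedR_row amplitude_stack.
  under eq_bigr => p _ do rewrite /pair_weight big_distrlr /=.
  rewrite exchange_big mulr_sumr /=; apply: eq_bigr => x1 _.
  rewrite exchange_big mulr_sumr /=; apply: eq_bigr => x2 _.
  rewrite !mulr_sumr; apply: eq_bigr => p _; rewrite /outer; ring.
transitivity (\sum_(s1 : cols) \sum_(s2 : cols) \sum_x1 \sum_x2 outer s1 s2 x1 x2 *
  \sum_Y (\sum_(p : cols) deltaA z2 s1 p None Y.1 * gammaA z1 p s2 (Some c1) Y.2)
    * mixedR v g z1 z2 Y (shift u x1, x2)).
  apply: eq_bigr => s1 _; apply: eq_bigr => s2 _; apply: eq_bigr => x1 _; apply: eq_bigr => x2 _.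
  rewrite (amplitude_intertwines s1 s2 _ _ (mixedR_intertwines g0 gN z2 z1_neq0)).
  by congr (_ * _); apply: eq_bigr => Y _; rewrite amplitude_stack.
transitivity (\sum_(s1 : cols) \sum_(s2 : cols) \sum_x1 \sum_x2 \sum_x2' \sum_y1
  \sum_(p : cols) outer s1 s2 x1 x2 *
  (deltaA z2 s1 p None x2' * gammaA z1 p s2 (Some c1) y1 * mixedR v g z1 z2 (x2', y1) (shift u x1, x2))).
  apply: eq_bigr => s1 _; apply: eq_bigr => s2 _; apply: eq_bigr => x1 _; apply: eq_bigr => x2 _.
  rewrite pair_bigA mulr_sumr; apply: eq_bigr => -[x2' y1] _ /=.
  by rewrite mulr_suml mulr_sumr.
transitivity (\sum_(p : cols) \sum_x1 \sum_x2' \sum_y1 \sum_x2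
  \sum_(s1 : cols) \sum_(s2 : cols) outer s1 s2 x1 x2 *
  (deltaA z2 s1 p None x2' * gammaA z1 p s2 (Some c1) y1 * mixedR v g z1 z2 (x2', y1) (shift u x1, x2))).
  rewrite !pair_bigA /= (reindex (fun q : cols * st * st * st * st * cols * cols =>
    let: (p, x1, x2', y1, x2, s1, s2) := q in (s1, s2, x1, x2, x2', y1, p))) /=.
    by apply: eq_bigr => -[[[[[[p x1] x2'] y1] x2] s1] s2].
  exists (fun q : cols * cols * st * st * st * st * cols =>
    let: (s1, s2, x1, x2, x2', y1, p) := q in (p, x1, x2', y1, x2, s1, s2)).
    by move=> [[[[[[p x1] x2'] y1] x2] s1] s2].
  by move=> [[[[[[s1 s2] x1] x2] x2'] y1] p].
apply: eq_bigr => p _.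
transitivity (\sum_x1 \sum_x2 \sum_y1 \sum_y2
   amplitude (stack (deltaK v g z1) (deltaK v g z2)) t p (None, None) (x1, x2)
   * amplitude (stack (gammaK v g z1) (gammaK v g z2)) p b (Some c1, Some c2) (y1, y2)
   * bend_pair v g z1 z2 (x1, x2) (y1, y2)); last first.
  rewrite pair_bigA; apply: eq_bigr => -[x1 x2] _; rewrite pair_bigA; apply: eq_bigr => -[y1 y2] _ //.
apply: eq_bigr => x1 _; apply: eq_bigr => x2' _; apply: eq_bigr => y1 _.
(* The sum over the right edge of row j-bar is reindexed by the edge of row j at the other end of
   the bend. *)
rewrite [RHS](reindex_onto (shift u) (shift (- u))) => [|y _]; last exact: shiftNK.
apply: eq_big => [x|x2 _]; first by rewrite shiftK eqxx.
rewrite !amplitude_stack /bend_pair /= shiftK big_distrlr mulr_suml; apply: eq_bigr => s1 _.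
rewrite mulr_suml; apply: eq_bigr => s2 _; rewrite /outer /=; ring.
Qed.

Hypothesis n_odd : odd m.+1.

(** The crossing of i and j enters at the left as a scalar, moves to the bends, becomes a crossing
    of i-bar and j-bar by [caduceus], and moves back to the left boundary. *)
Lemma sorted_strip_swap z1 z2 c1 c2 t b : z1 != 0 -> z2 != 0 ->
  (z1 ^+ m.+1 - v * z2 ^+ m.+1) *
    sorted_strip (stack (deltaK v g z1) (deltaK v g z2)) (stack (gammaK v g z1) (gammaK v g z2))
      t b (None, None) (Some c1, Some c2) (bend_pair v g z1 z2)
  = \sum_M gammaR v g z2 z1 (Some c1, Some c2) M *
    sorted_strip (stack (deltaK v g z2) (deltaK v g z1)) (stack (gammaK v g z2) (gammaK v g z1))
      t b (None, None) M (bend_pair v g z2 z1).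
Proof.
move=> z1_neq0 z2_neq0.
under [RHS]eq_bigr do rewrite mulr_sumr.
rewrite [RHS]exchange_big mulr_sumr; apply: eq_bigr => p _ /=.
set D12 := amplitude (stack (deltaK v g z1) _) _ _; set D21 := amplitude (stack (deltaK v g z2) _) _ _.
set G12 := amplitude (stack (gammaK v g z1) _) _ _; set G21 := amplitude (stack (gammaK v g z2) _) _ _.
have deltaE X : (z1 ^+ m.+1 - v * z2 ^+ m.+1) * D12 (None, None) X
              = \sum_W D21 (None, None) W * deltaR v g z1 z2 W X.
  rewrite -(amplitude_intertwines t p _ _ (deltaR_intertwines g0 gN z1 z2)).
  by rewrite (sum_deltaR_row v g z1 z2 (None, None) (fun W => D12 W X)).
have mulrACA4 (k l q w : F) : k * (l * q * w) = k * l * (q * w) by ring.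
transitivity (\sum_W \sum_Y D21 (None, None) W * G12 (Some c1, Some c2) Y *
              \sum_X deltaR v g z1 z2 W X * bend_pair v g z1 z2 X Y).
  rewrite mulr_sumr.
  under eq_bigr do rewrite mulr_sumr.
  under eq_bigr => X _ do under eq_bigr => Y _ do rewrite mulrACA4 deltaE mulr_suml.
  under eq_bigr do rewrite exchange_big.
  rewrite exchange_big; apply: eq_bigr => W _ /=.
  rewrite exchange_big; apply: eq_bigr => Y _ /=.
  rewrite mulr_sumr; apply: eq_bigr => X _; ring.
transitivity (\sum_W \sum_Y' D21 (None, None) W *
  (\sum_Y G12 (Some c1, Some c2) Y * gammaR v g z2 z1 Y Y') * bend_pair v g z2 z1 W Y').
  apply: eq_bigr => W _.
  transitivity (\sum_Y \sum_Y' D21 (None, None) W * G12 (Some c1, Some c2) Y *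
     (gammaR v g z2 z1 Y Y' * bend_pair v g z2 z1 W Y')).
    by apply: eq_bigr => Y _; rewrite caduceus // mulr_sumr.
  rewrite exchange_big; apply: eq_bigr => Y' _ /=.
  by rewrite mulr_sumr mulr_suml; apply: eq_bigr => Y _; ring.
under [RHS]eq_bigr do rewrite mulr_sumr.
rewrite [RHS]exchange_big; apply: eq_bigr => W _ /=.
under [RHS]eq_bigr do rewrite mulr_sumr.
rewrite [RHS]exchange_big; apply: eq_bigr => Y' _ /=.
rewrite -(amplitude_intertwines p b _ _ (gammaR_intertwines g0 gN z2_neq0 z1_neq0)).
by rewrite mulr_sumr mulr_suml; apply: eq_bigr => M _; rewrite /G21; ring.
Qed.

(** The column of [deltaR] at [(Some c1, Some c2)] keeps the two charges or exchanges them, which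
    gives the two terms. The sorting scalar is symmetric in [z1] and [z2], so it cancels. *)
Lemma strip_exchange z1 z2 c1 c2 t b : z1 != 0 -> z2 != 0 ->
  1 - v * (z1 * z2) ^+ m.+1 != 0 ->
  (z1 ^+ m.+1 - v * z2 ^+ m.+1) * strip_weight z1 z2 c1 c2 t b
  = mono v z1 z2 (c2 - c1) * strip_weight z2 z1 c1 c2 t b
    + g (c1 - c2) * (z1 ^+ m.+1 - z2 ^+ m.+1) * strip_weight z2 z1 c2 c1 t b.
Proof.
move=> z1_neq0 z2_neq0 al_neq0; apply: (mulfI al_neq0).
rewrite mulrCA strip_sort // sorted_strip_swap //.
transitivity (\sum_M deltaR v g z1 z2 M (Some c1, Some c2) *
  (z1 * z2 / (gauge z2 M.1 * gauge z1 M.2) *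
   sorted_strip (stack (deltaK v g z2) (deltaK v g z1)) (stack (gammaK v g z2) (gammaK v g z1))
      t b (None, None) M (bend_pair v g z2 z1))).
  by apply: eq_bigr => M _; rewrite /gammaR /=; ring.
rewrite sum_deltaR_col /= -!strip_sort // [z2 * z1]mulrC divff ?mulf_neq0 //; ring.
Qed.
End Strip.

(** * Cancelling the scalar of the first crossing *)

Section Laurent.
Variable F : numFieldType.
Implicit Types f h : F -> F.

Definition laurent f :=
  exists p : {poly F}, exists k, forall z, z != 0 -> f z * z ^+ k = p.[z].

Lemma eq_laurent f h : f =1 h -> laurent f -> laurent h.
Proof. by move=> fh [p [k pE]]; exists p, k => z z0; rewrite -fh pE. Qed.

Lemma laurent_horner p : laurent (fun z => p.[z]).
Proof. by exists p, 0%N => z _; rewrite mulr1. Qed.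

Lemma laurent_const a : laurent (fun=> a).
Proof. by apply: eq_laurent (laurent_horner a%:P) => z; rewrite hornerC. Qed.

Lemma laurent_id : laurent (fun z => z).
Proof. by apply: eq_laurent (laurent_horner 'X) => z; rewrite hornerX. Qed.

Lemma laurent_inv : laurent (fun z => z^-1).
Proof. by exists 1, 1%N => z z0; rewrite mulVf // hornerC. Qed.

Lemma laurentD f h : laurent f -> laurent h -> laurent (fun z => f z + h z).
Proof.
move=> [p [k pE]] [q [l qE]]; exists (p * 'X^l + q * 'X^k), (k + l)%N => z z0.
rewrite hornerD !hornerM !hornerXn -pE // -qE // exprD; ring.
Qed.

Lemma laurentM f h : laurent f -> laurent h -> laurent (fun z => f z * h z).
Proof.
move=> [p [k pE]] [q [l qE]]; exists (p * q), (k + l)%N => z z0.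
rewrite hornerM -pE // -qE // exprD; ring.
Qed.

Lemma laurentX f k : laurent f -> laurent (fun z => f z ^+ k).
Proof.
move=> lf; elim: k => [|k IH]; first exact: laurent_const.
by apply: eq_laurent (laurentM lf IH) => z; rewrite exprS.
Qed.

Lemma laurentN f : laurent f -> laurent (fun z => - f z).
Proof.
by move=> lf; apply: eq_laurent (laurentM (laurent_const (-1)) lf) => z; rewrite mulN1r.
Qed.

Lemma laurent_sum (I : finType) (f : I -> F -> F) :
  (forall i, laurent (f i)) -> laurent (fun z => \sum_i f i z).
Proof.
move=> lf; elim: (index_enum I) => [|i r IH].
  by apply: eq_laurent (laurent_const 0) => z; rewrite big_nil.
by apply: eq_laurent (laurentD (lf i) IH) => z; rewrite big_cons.
Qed.

(** In characteristic zero the points 0, 1, 2, ... are distinct, and there are more of them than a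
    nonzero polynomial has roots. *)
Lemma horner_eq0_all (p : {poly F}) : (forall z, p.[z] = 0) -> p = 0.
Proof.
move=> p0; apply/eqP/negPn/negP => pN0.
pose r : seq F := [seq i%:R | i <- iota 0 (size p)].
have r_uniq : uniq r.
  by rewrite map_inj_uniq ?iota_uniq // => i j /eqP; rewrite eqr_nat => /eqP.
have r_roots : all (root p) r by apply/allP => z _; apply/eqP.
by have := max_poly_roots pN0 r_roots r_uniq; rewrite size_map size_iota ltnn.
Qed.

(** Multiplication by [q] and by X covers the excluded points, so the polynomial behind [f] vanishes
    identically. *)
Lemma laurent_eq0 f (q : {poly F}) : laurent f -> q != 0 ->
  (forall z, z != 0 -> q.[z] != 0 -> f z = 0) -> forall z, z != 0 -> f z = 0.
Proof.
move=> [p [k pE]] q0 f0 z z0.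
suff p0 : p = 0.
  by have /eqP := pE z z0; rewrite p0 horner0 mulf_eq0 expf_eq0 (negPf z0) andbF orbF => /eqP.
have : p * (q * 'X) = 0.
  apply: horner_eq0_all => w; rewrite !hornerM hornerX.
  have [->|w0] := eqVneq w 0; first by rewrite !mulr0.
  have [->|qw0] := eqVneq q.[w] 0; first by rewrite mul0r mulr0.
  by rewrite -pE // f0 // !mul0r.
by move/eqP; rewrite !mulf_eq0 (negPf q0) polyX_eq0 !orbF => /eqP.
Qed.

Variables (m : nat) (v : F) (g : 'I_m.+1 -> F) (N : nat).
Local Notation st := (option 'I_m.+1).

Lemma laurent_deltaK t b x y : laurent (fun z => deltaK v g z t b x y).
Proof.
case: x y => [x|] [y|] /=; do ?[exact: laurent_const | exact: laurent_id | apply: laurentM].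
Qed.

Lemma laurent_gammaK t b x y : laurent (fun z => gammaK v g z t b x y).
Proof.
case: x y => [x|] [y|] /=; do ?[exact: laurent_const | exact: laurent_inv | apply: laurentM].
Qed.

Lemma laurent_bend x : laurent (fun z => bend g z x).
Proof.
case: x => [x|] /=; last exact: laurent_inv.
by apply: laurentM; [exact: laurent_const | exact: laurent_id].
Qed.

Lemma laurent_amplitude (S : finType) (K : F -> kernel F S) n (t b : 'I_n -> bool) x y :
  (forall t b x y, laurent (fun z => K z t b x y)) ->
  laurent (fun z => amplitude (K z) t b x y).
Proof.
move=> lK; elim: n t b y => [|n IH] t b y /=; first exact: laurent_const.
by apply: laurent_sum => w; apply: laurentM.
Qed.

Lemma laurent_pair_weight c (t s b : {ffun 'I_N -> bool}) :
  laurent (fun z => pair_weight v g z c t s b).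
Proof.
apply: laurent_sum => x; apply: laurentM; last first.
  by apply: laurent_amplitude => *; exact: laurent_gammaK.
apply: laurentM; last exact: laurent_bend.
by apply: laurent_amplitude => *; exact: laurent_deltaK.
Qed.

Hypothesis g0 : g 0 = - v.
Hypothesis gN : forall x : 'I_m.+1, x != 0 -> g x * g (- x) = v.
Hypothesis n_odd : odd m.+1.

Lemma strip_exchange_all z1 z2 c1 c2 (t b : {ffun 'I_N -> bool}) : z1 != 0 -> z2 != 0 ->
  (z1 ^+ m.+1 - v * z2 ^+ m.+1) * strip_weight v g z1 z2 c1 c2 t b
  = mono v z1 z2 (c2 - c1) * strip_weight v g z2 z1 c1 c2 t b
    + g (c1 - c2) * (z1 ^+ m.+1 - z2 ^+ m.+1) * strip_weight v g z2 z1 c2 c1 t b.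
Proof.
move=> z1_neq0 z2_neq0; apply/eqP; rewrite -subr_eq0; apply/eqP; move: z1 z1_neq0.
(* [q] is the scalar of the first crossing as a polynomial in [z1]; its constant term is 1, so it is
   nonzero. *)
pose q : {poly F} := 1 - (v * z2 ^+ m.+1)%:P * 'X^(m.+1).
have qE z : q.[z] = 1 - v * (z * z2) ^+ m.+1.
  by rewrite /q hornerD hornerN hornerM !hornerC hornerXn exprMn; ring.
apply: (laurent_eq0 (q := q)) => [||z z0 qz0].
- have lpow : laurent (fun z => z ^+ m.+1) by apply/laurentX/laurent_id.
  have ldiff a : laurent (fun z => z ^+ m.+1 - a) by apply: laurentD => //; apply/laurent_const.
  have lstrip c d : laurent (fun z => strip_weight v g z z2 c d t b).
    apply: laurent_sum => s1; apply: laurent_sum => p; apply: laurent_sum => s2.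
    by apply: laurentM; [exact: laurent_pair_weight | exact: laurent_const].
  have lstrip' c d : laurent (fun z => strip_weight v g z2 z c d t b).
    apply: laurent_sum => s1; apply: laurent_sum => p; apply: laurent_sum => s2.
    by apply: laurentM; [exact: laurent_const | exact: laurent_pair_weight].
  apply: laurentD; first exact: laurentM.
  apply/laurentN/laurentD; first apply: laurentM => //.
    by apply: laurentM; [apply: laurentM; [|apply/laurentX/laurent_id] |]; exact: laurent_const.
  by apply: laurentM => //; apply: laurentM => //; exact: laurent_const.
- apply/eqP => /(congr1 (horner^~ 0)); rewrite qE horner0 mul0r expr0n mulr0 subr0.
  by move/eqP; rewrite oner_eq0.
by apply/eqP; rewrite subr_eq0; apply/eqP/strip_exchange => //; rewrite -qE.
Qed.
End Laurent.

(** * The partition function as a product of double rows *)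

Section Rows.
Variables (F : fieldType) (m : nat) (v : F) (g : 'I_m.+1 -> F) (z : F).
Local Notation u := (residue_one m).
Local Notation row N := {ffun 'I_N -> bool}.

Definition delta_vertex (ga ha da : F) (cfg : option six_vertex) : F :=
  match cfg with
  | Some A1 => 1
  | Some A2 => ga * z
  | Some B1 => 1
  | Some B2 => z
  | Some C1 => ha * z
  | Some C2 => da
  | None => 0
  end.

Definition gamma_vertex (ga ha da : F) (cfg : option six_vertex) : F :=
  match cfg with
  | Some A1 => 1
  | Some A2 => z^-1
  | Some B1 => ga
  | Some B2 => z^-1
  | Some C1 => ha * z^-1
  | Some C2 => da
  | None => 0
  end.

Definition delta_weight (a : 'I_m.+1) := delta_vertex (g a) ((1 - v) * (a == 0)%:R) (a == 0)%:R.
Definition gamma_weight (a : 'I_m.+1) := gamma_vertex (g a) ((1 - v) * (a == 0)%:R) (a == 0)%:R.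

Definition row_config N (t b : 'I_N -> bool) (h : row N.+1) (c : 'I_N) :=
  six_vertex_of (h (left_edge c)) (h (right_edge c)) (t c) (b c).

Definition minus_from N (h : row N.+1) (e : 'I_N.+1) : nat :=
  #|[set e' : 'I_N.+1 | (e <= e')%N & h e' == spin_minus]|.
Definition plus_to N (h : row N.+1) (e : 'I_N.+1) : nat :=
  #|[set e' : 'I_N.+1 | (e' <= e)%N & h e' == spin_plus]|.

Definition delta_row N (t b : 'I_N -> bool) (h : row N.+1) : F :=
  \prod_c delta_weight (inZp (minus_from h (left_edge c))) (row_config t b h c).
Definition gamma_row N (t b : 'I_N -> bool) (q : nat) (h : row N.+1) : F :=
  \prod_c gamma_weight (inZp (q + plus_to h (right_edge c))) (row_config t b h c).

Lemma card_set_sum (T : finType) (P : pred T) : #|[set x | P x]| = (\sum_x P x)%N.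
Proof. by rewrite cardsE -sum1_card big_mkcond; apply: eq_bigr => x _; rewrite unfold_in; case: (P x). Qed.

Lemma minus_from_cons0 N s (h : row N.+1) :
  minus_from (ffun_cons s h) ord0 = (s + minus_from h ord0)%N.
Proof.
rewrite /minus_from !card_set_sum big_ord_recl ffun_cons0 eqb_id; congr (_ + _)%N.
by apply: eq_bigr => e _; rewrite ffun_consS.
Qed.

Lemma minus_from_consS N s (h : row N.+1) e :
  minus_from (ffun_cons s h) (lift ord0 e) = minus_from h e.
Proof.
rewrite /minus_from !card_set_sum big_ord_recl add0n.
by apply: eq_bigr => e' _; rewrite ffun_consS.
Qed.

Lemma plus_to_cons0 N s (h : row N.+1) : plus_to (ffun_cons s h) ord0 = ~~ s.
Proof.
rewrite /plus_to card_set_sum big_ord_recl ffun_cons0 eqbF_neg leqnn big1 ?addn0 //.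
Qed.

Lemma plus_to_consS N s (h : row N.+1) e :
  plus_to (ffun_cons s h) (lift ord0 e) = (~~ s + plus_to h e)%N.
Proof.
rewrite /plus_to !card_set_sum big_ord_recl ffun_cons0 eqbF_neg; congr (_ + _)%N.
by apply: eq_bigr => e' _; rewrite ffun_consS.
Qed.

Lemma left_edgeS N (c : 'I_N) : left_edge (lift ord0 c) = lift ord0 (left_edge c).
Proof. by []. Qed.
Lemma right_edgeS N (c : 'I_N) : right_edge (lift ord0 c) = lift ord0 (right_edge c).
Proof. exact: val_inj. Qed.
Lemma left_edge0 N : left_edge (ord0 : 'I_N.+1) = lift ord0 ord0.
Proof. by []. Qed.
Lemma right_edge0 N : right_edge (ord0 : 'I_N.+1) = ord0.
Proof. exact: val_inj. Qed.
Lemma lift_ord_max N : (ord_max : 'I_N.+2) = lift ord0 ord_max.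
Proof. exact: val_inj. Qed.

Lemma inZpD (a b : nat) : inZp (a + b) = inZp a + inZp b :> 'I_m.+1.
Proof. by apply: val_inj; rewrite /= modnDm. Qed.

Lemma inZp_spin (s : bool) : inZp s = (if s then u else 0) :> 'I_m.+1.
Proof. by case: s; rewrite /residue_one -?lock //; apply: val_inj. Qed.

Lemma delta_row_cons N (t b : 'I_N.+1 -> bool) s (h : row N.+1) :
  delta_row t b (ffun_cons s h)
  = delta_weight (inZp (minus_from h ord0)) (six_vertex_of (h ord0) s (t ord0) (b ord0))
    * delta_row (fun i => t (lift ord0 i)) (fun i => b (lift ord0 i)) h.
Proof.
rewrite /delta_row big_ord_recl /row_config left_edge0 right_edge0.
rewrite minus_from_consS ffun_cons0 ffun_consS; congr (_ * _); apply: eq_bigr => c _.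
by rewrite left_edgeS right_edgeS minus_from_consS !ffun_consS.
Qed.

(** The removed edge is counted in the starting charge, so the shorter row has the same form, with
    another [q]. *)
Lemma gamma_row_cons N (t b : 'I_N.+1 -> bool) q s (h : row N.+1) :
  gamma_row t b q (ffun_cons s h)
  = gamma_weight (inZp (q + ~~ s)) (six_vertex_of (h ord0) s (t ord0) (b ord0))
    * gamma_row (fun i => t (lift ord0 i)) (fun i => b (lift ord0 i)) (q + ~~ s) h.
Proof.
rewrite /gamma_row big_ord_recl /row_config left_edge0 right_edge0.
rewrite plus_to_cons0 ffun_cons0 ffun_consS; congr (_ * _); apply: eq_bigr => c _.
by rewrite left_edgeS right_edgeS plus_to_consS !ffun_consS addnA.
Qed.

Lemma minus_from1 (h : row 1) : minus_from h ord0 = h ord0.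
Proof. by rewrite /minus_from card_set_sum big_ord_recl big_ord0 addn0 eqb_id. Qed.

Lemma plus_to1 (h : row 1) : plus_to h ord0 = ~~ h ord0.
Proof. by rewrite /plus_to card_set_sum big_ord_recl big_ord0 addn0 eqbF_neg. Qed.

Lemma sum_row1 (f : row 1 -> F) : \sum_h f h = f [ffun=> true] + f [ffun=> false].
Proof.
rewrite sum_ffun_cons big_bool !(sum_ffun_ord0 _ [ffun=> true]).
by congr (f _ + f _); apply/ffunP => i; rewrite (ord1 i) ffun_cons0 ffunE.
Qed.

(** The factor [(a == 0)%:R] holds because [C2] leaves a + edge only at charge 0 and [C1] returns to
    one only at charge 0, modulo n. *)
Lemma sum_delta_row N (t b : 'I_N -> bool) (s : bool) (a : 'I_m.+1) :
  \sum_(h : row N.+1) [&& ~~ h ord_max, h ord0 == s & inZp (minus_from h ord0) == a]%:R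
     * delta_row t b h
  = if s then amplitude (deltaK v g z) t b None (Some a)
    else (a == 0)%:R * amplitude (deltaK v g z) t b None None.
Proof.
elim: N t b s a => [|N IH] t b s a.
  rewrite sum_row1 !minus_from1 (ord1 ord_max) !ffunE /delta_row !big_ord0 !inZp_spin /=.
  by rewrite mul0r add0r !mulr1 [0 == a]eq_sym; case: s.
pose t' (i : 'I_N) := t (lift ord0 i); pose b' (i : 'I_N) := b (lift ord0 i).
(* [A] is the sum for the shorter row, sorted by the spin and charge of the left edge of the removed
   vertex. *)
pose A (s' : bool) (a' : 'I_m.+1) : F :=
  \sum_(h : row N.+1) [&& ~~ h ord_max, h ord0 == s' & inZp (minus_from h ord0) == a']%:R
     * delta_row t' b' h.
transitivity (\sum_(s' : bool) \sum_(a' : 'I_m.+1) A s' a' * (((if s then u else 0) + a' == a)%:R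
   * delta_weight a' (six_vertex_of s' s (t ord0) (b ord0)))).
  rewrite sum_ffun_cons (bigD1 s) //= [X in _ + X]big1 ?addr0 => [|s0 /negPf s0s]; last first.
    by rewrite big1 // => h _; rewrite ffun_cons0 s0s andbF mul0r.
  under eq_bigr => h _ do
    rewrite lift_ord_max ffun_consS ffun_cons0 eqxx minus_from_cons0 delta_row_cons inZpD inZp_spin /=.
  under [RHS]eq_bigr do under eq_bigr do rewrite mulr_suml.
  under [RHS]eq_bigr do rewrite exchange_big /=.
  rewrite [RHS]exchange_big; apply: eq_bigr => h _ /=.
  rewrite (bigD1 (h ord0)) //= [X in _ = _ + X]big1 ?addr0 => [|s' /negPf s's]; last first.
    by rewrite big1 // => a' _; rewrite [h ord0 == _]eq_sym s's andbF !mul0r.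
  rewrite (bigD1 (inZp (minus_from h ord0))) //= [X in _ = _ + X]big1 ?addr0 => [|a' /negPf a'a]; last first.
    by rewrite [inZp _ == _]eq_sym a'a !andbF !mul0r.
  rewrite !eqxx !andbT -mulnb natrM; ring.
rewrite big_bool /A /=; under eq_bigr do rewrite IH.
under [X in _ + X]eq_bigr do rewrite IH -mulrA.
rewrite sum_delta.
case: s; rewrite big_option addrC /=.
  congr (_ + _); [|apply: eq_bigr => x _]; congr (_ * _).
    by rewrite addr0 eq_sym /delta_weight eqxx; case: (t ord0) (b ord0) => [] [] /=; ring.
  by rewrite addrC eq_sym; case: (t ord0) (b ord0) => [] [] /=; ring.
rewrite addr0 mulrDr mulr_sumr eq_sym; congr (_ + _); [|apply: eq_bigr => x _].
  by case: (t ord0) (b ord0) => [] [] /=; ring.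
rewrite add0r /delta_weight eq_sym; case: (eqVneq x 0) => [->|x0].
  by rewrite eq_sym; case: (t ord0) (b ord0) => [] [] /=; ring.
by case: (t ord0) (b ord0) => [] [] /=; ring.
Qed.

(** [q] is the charge of the bend. A + right edge counts itself, whence [inZp q + u]; a - right edge
    contributes only at charge 0 modulo n. *)
Lemma sum_gamma_row N (t b : 'I_N -> bool) (s : bool) (q : nat) (c : 'I_m.+1) :
  \sum_(h : row N.+1) [&& ~~ h ord_max, h ord0 == s & inZp (q + plus_to h ord_max) == c]%:R
     * gamma_row t b q h
  = if s then (inZp q == 0 :> 'I_m.+1)%:R * amplitude (gammaK v g z) t b (Some c) None
    else amplitude (gammaK v g z) t b (Some c) (Some (inZp q + u)).
Proof.
elim: N t b s q => [|N IH] t b s q.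
  rewrite sum_row1 (ord1 ord_max) !plus_to1 !ffunE /gamma_row !big_ord0 !inZpD !inZp_spin /=.
  by rewrite mul0r add0r !mulr1; case: s => /=; rewrite ?mulr0 // -(inj_eq (@Some_inj _)) eq_sym.
pose t' (i : 'I_N) := t (lift ord0 i); pose b' (i : 'I_N) := b (lift ord0 i).
transitivity (\sum_(s' : bool) gamma_weight (inZp (q + ~~ s)) (six_vertex_of s' s (t ord0) (b ord0)) *
  \sum_(h : row N.+1) [&& ~~ h ord_max, h ord0 == s' & inZp (q + ~~ s + plus_to h ord_max) == c]%:R
     * gamma_row t' b' (q + ~~ s) h).
  rewrite sum_ffun_cons (bigD1 s) //= [X in _ + X]big1 ?addr0 => [|s0 /negPf s0s]; last first.
    by rewrite big1 // => h _; rewrite ffun_cons0 s0s andbF mul0r.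
  under [RHS]eq_bigr do rewrite mulr_sumr.
  rewrite [RHS]exchange_big; apply: eq_bigr => h _ /=.
  rewrite lift_ord_max ffun_consS ffun_cons0 eqxx plus_to_consS gamma_row_cons addnA /=.
  rewrite (bigD1 (h ord0)) //= [X in _ = _ + X]big1 ?addr0 => [|s' /negPf s's]; last first.
    by rewrite [h ord0 == _]eq_sym s's andbF mul0r mulr0.
  by rewrite eqxx; ring.
rewrite big_bool /= !IH /gamma_weight inZpD inZp_spin; case: s => /=.
  rewrite addr0 big_option /= mulrDr.
  congr (_ + _); first by case: (t ord0) (b ord0) => [] [] /=; ring.
  case: (eqVneq (inZp q : 'I_m.+1) 0) => [->|q0].
    rewrite add0r (bigD1 u) //= big1 => [|x /negPf xu]; last by rewrite xu !mulr0.
    by rewrite eqxx; case: (t ord0) (b ord0) => [] [] /=; ring.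
  by case: (t ord0) (b ord0) => [] [] /=; ring.
set a := inZp q + u; rewrite big_option /=; congr (_ + _).
  by case: (eqVneq a 0) => [->|a0]; case: (t ord0) (b ord0) => [] [] /=; ring.
rewrite (bigD1 (a + u)) //= big1 => [|x /negPf xa]; last by rewrite xa mul0r !mulr0.
by rewrite eqxx; case: (t ord0) (b ord0) => [] [] /=; ring.
Qed.

End Rows.

(** * Double rows joined by a bend *)

Section PairSum.
Variables (F : fieldType) (m : nat) (v : F) (g : 'I_m.+1 -> F) (z : F) (N : nat).
Local Notation u := (residue_one m).
Local Notation row := {ffun 'I_N.+1 -> bool}.

Definition bend_vertex (ga : F) (sd sg : bool) : F :=
  match sd, sg with
  | spin_minus, spin_plus => ga * z
  | spin_plus, spin_minus => z^-1
  | _, _ => 0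
  end.

Definition pair_admissible (c : 'I_m.+1) (hd hg : row) : bool :=
  [&& ~~ hd ord_max, ~~ hg ord_max, hd ord0 != hg ord0
    & inZp (minus_from hd ord0 + plus_to hg ord_max) == c].

Lemma sum_pair (t s b : {ffun 'I_N -> bool}) c :
  \sum_(hd : row) \sum_(hg : row) (pair_admissible c hd hg)%:R *
    (delta_row v g z t s hd * bend_vertex (g (inZp (2 * minus_from hd ord0))) (hd ord0) (hg ord0)
     * gamma_row v g z s b (minus_from hd ord0) hg)
  = pair_weight v g z c t s b.
Proof.
(* [B] is the contribution of the bend and the Gamma row, which depends on the Delta row only
   through the spin and charge at its right end. *)
pose B (s' : bool) (a : 'I_m.+1) : F :=
  if s' then g (a + a) * z * amplitude (gammaK v g z) s b (Some c) (Some (a + u))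
  else z^-1 * ((a == 0)%:R * amplitude (gammaK v g z) s b (Some c) None).
transitivity (\sum_(hd : row) (~~ hd ord_max)%:R * delta_row v g z t s hd *
    B (hd ord0) (inZp (minus_from hd ord0))).
  apply: eq_bigr => hd _; set q := minus_from hd ord0.
  transitivity ((~~ hd ord_max)%:R * delta_row v g z t s hd *
     (bend_vertex (g (inZp (2 * q))) (hd ord0) (~~ hd ord0) *
       \sum_(hg : row) [&& ~~ hg ord_max, hg ord0 == ~~ hd ord0 & inZp (q + plus_to hg ord_max) == c]%:R
         * gamma_row v g z s b q hg)).
    rewrite !mulr_sumr; apply: eq_bigr => hg _; rewrite /pair_admissible -/q.
    by case: (hd ord_max) (hg ord_max) (hd ord0) (hg ord0) (_ == c) => [] [] [] [] [] /=; ring.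
  by congr (_ * _); rewrite sum_gamma_row /B mul2n -addnn inZpD; case: (hd ord0).
transitivity (\sum_(s' : bool) \sum_(a : 'I_m.+1)
    (\sum_(hd : row) [&& ~~ hd ord_max, hd ord0 == s' & inZp (minus_from hd ord0) == a]%:R
       * delta_row v g z t s hd) * B s' a).
  under [RHS]eq_bigr do under eq_bigr do rewrite mulr_suml.
  under [RHS]eq_bigr do rewrite exchange_big /=.
  rewrite [RHS]exchange_big; apply: eq_bigr => h _ /=.
  rewrite (bigD1 (h ord0)) //= [X in _ = _ + X]big1 ?addr0 => [|s' /negPf s's]; last first.
    by rewrite big1 // => a' _; rewrite [h ord0 == _]eq_sym s's andbF !mul0r.
  rewrite (bigD1 (inZp (minus_from h ord0))) //= [X in _ = _ + X]big1 ?addr0 => [|a' /negPf a'a]; last first.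
    by rewrite [inZp _ == _]eq_sym a'a !andbF !mul0r.
  by rewrite !eqxx !andbT.
rewrite big_bool /= /pair_weight big_option addrC.
congr (_ + _).
  under eq_bigr do rewrite sum_delta_row /B /=.
  rewrite (bigD1 0) //= big1 ?addr0 => [|a /negPf a0]; last by rewrite a0 !mul0r.
  by rewrite ?eqxx; ring.
by apply: eq_bigr => a _; rewrite sum_delta_row /B /=; ring.
Qed.
End PairSum.

(** * Decomposition of states into rows of horizontal and vertical edges *)

Section PartitionFunction.
Variables (F : fieldType) (m r : nat) (v : F) (g : int -> F) (z : 'I_r -> F).
Variables (lam : r.-tuple nat) (cs : 'I_r -> int) (c : 'I_r -> 'I_m.+1).
Local Notation N := (head 0%N lam + r)%N.
Local Notation row := {ffun 'I_N.+1 -> bool}.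
Local Notation cols := {ffun 'I_N -> bool}.
Local Notation gI := (fun x : 'I_m.+1 => g x%:Z).

Hypothesis g_periodic : forall a : int, g (a + m.+1%:Z) = g a.
Hypothesis csE : forall k, cs k = (c k)%:Z.

Definition assemble (H : {ffun 'I_r -> row * row}) (V : {ffun 'I_(r.*2).+1 -> cols}) : state r N :=
  ([ffun x : 'I_r * bool * 'I_N.+1 => (if x.1.2 then (H x.1.1).2 else (H x.1.1).1) x.2],
   [ffun x : 'I_(r.*2).+1 * 'I_N => V x.1 x.2]).

Definition boundary (V : {ffun 'I_(r.*2).+1 -> cols}) : bool :=
  (V ord_max == [ffun=> false]) && (V ord0 == [ffun i => top_minus lam i]).

Lemma sum_assemble (f : state r N -> F) : \sum_s f s = \sum_H \sum_V f (assemble H V).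
Proof.
rewrite pair_bigA (reindex (fun p => assemble p.1 p.2)) //=.
exists (fun s : state r N =>
  ([ffun k => ([ffun e => s.1 (k, false, e)], [ffun e => s.1 (k, true, e)])],
   [ffun p => [ffun i => s.2 (p, i)]])) => [[H V]|[h w]] _ /=.
  congr (_, _); apply/ffunP => k; rewrite ffunE; last by apply/ffunP => i; rewrite !ffunE.
  by case E: (H k) => [h1 h2]; congr (_, _); apply/ffunP => e; rewrite !ffunE /= E.
congr (_, _); apply/ffunP => -[k e]; rewrite !ffunE //=.
by case: k => k [] /=; rewrite !ffunE.
Qed.

Section State.
Variables (H : {ffun 'I_r -> row * row}) (V : {ffun 'I_(r.*2).+1 -> cols}).
Local Notation s := (assemble H V).

Lemma hspinE k b e : hspin s k b e = (if b then (H k).2 else (H k).1) e.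
Proof. by rewrite /hspin ffunE. Qed.

Lemma vspinE p i : vspin s p i = V p i.
Proof. by rewrite /vspin ffunE. Qed.

Lemma charge_deltaE k e : charge_delta s k e = minus_from (H k).1 e.
Proof. by apply: eq_card => e'; rewrite !inE hspinE. Qed.

Lemma charge_gammaE k e :
  charge_gamma s k e = (minus_from (H k).1 ord0 + plus_to (H k).2 e)%N.
Proof.
rewrite /charge_gamma /charge_bend charge_deltaE; congr (_ + _)%N.
by apply: eq_card => e'; rewrite !inE hspinE.
Qed.

Lemma bottom_edge_delta (k : 'I_r) : bottom_edge k false = top_edge k true.
Proof. by rewrite /bottom_edge /top_edge addn0 addn1. Qed.

Lemma g_residue (a : nat) : g a = gI (inZp a).
Proof.
have periodic q (b : nat) : g (b + q * m.+1)%N = g b.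
  by elim: q => [|q IH]; rewrite ?addn0 // mulSn addnCA addnC PoszD g_periodic.
by rewrite {1}(divn_eq a m.+1) addnC periodic.
Qed.

Lemma delta_residue (a : nat) : delta F m.+1 a = (inZp a == 0 :> 'I_m.+1)%:R.
Proof. by rewrite /delta dvdzE /= /dvdn. Qed.

Lemma residue_eqz (a : nat) (x : 'I_m.+1) :
  (a%:Z == (x : nat)%:Z %[mod m.+1])%Z = (inZp a == x).
Proof. by rewrite !modz_nat eqz_nat -val_eqE /= [in X in _ == X]modn_small. Qed.

Lemma weight_assemble : weight m.+1 v g z s =
  \prod_k (delta_row v gI (z k) (V (top_edge k false)) (V (top_edge k true)) (H k).1
    * bend_vertex (z k) (gI (inZp (2 * minus_from (H k).1 ord0))) ((H k).1 ord0) ((H k).2 ord0)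
    * gamma_row v gI (z k) (V (top_edge k true)) (V (bottom_edge k true)) (minus_from (H k).1 ord0) (H k).2).
Proof.
apply: eq_bigr => k _; congr (_ * _ * _).
- apply: eq_bigr => i _; rewrite /weight_delta /vertex_config !hspinE !vspinE bottom_edge_delta.
  by rewrite /h g_residue delta_residue charge_deltaE.
- by rewrite /weight_bend !hspinE -PoszM g_residue /charge_bend charge_deltaE.
apply: eq_bigr => i _; rewrite /weight_gamma /vertex_config !hspinE !vspinE.
by rewrite /h g_residue delta_residue charge_gammaE.
Qed.

Lemma weight_eq0 k b i : vertex_config s k b i = None -> weight m.+1 v g z s = 0.
Proof.
move=> cfg; rewrite /weight (bigD1 k) //=; case: b cfg => cfg.
  suff -> : \prod_i weight_gamma m.+1 v g z s k i = 0 by rewrite mulr0 mul0r.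
  by rewrite (bigD1 i) //= /weight_gamma cfg mul0r.
suff -> : \prod_i weight_delta m.+1 v g z s k i = 0 by rewrite !mul0r.
by rewrite (bigD1 i) //= /weight_delta cfg mul0r.
Qed.

(** The indicators agree when all vertices have one of the six configurations, and otherwise the
    weight is 0. The second indicator splits into conditions on the separate double rows. *)
Lemma admissible_weight :
  (admissible lam s && left_charges m.+1 s cs)%:R * weight m.+1 v g z s
  = (boundary V && [forall k, pair_admissible (c k) (H k).1 (H k).2])%:R * weight m.+1 v g z s.
Proof.
case: (boolP [forall k, forall b, forall i, isSome (vertex_config s k b i)]) => [cfgs|]; last first.
  case/forallPn => k; case/forallPn => b; case/forallPn => i; case E: vertex_config => // _.
  by rewrite (weight_eq0 E) !mulr0.
congr ((nat_of_bool _)%:R * _); rewrite /admissible cfgs /boundary andbT.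
apply/andP/andP => [[/and4P[left bot top bend]] /forallP charges|[/andP[/eqP bot /eqP top] /forallP pairs]].
  split.
    apply/andP; split; apply/eqP/ffunP => i; rewrite ffunE.
      by have /forallP/(_ i)/eqP := bot; rewrite vspinE.
    by have /forallP/(_ i)/eqP := top; rewrite vspinE; case: ifP.
  apply/forallP => k; have /forallP/(_ k)/forallP left_k := left.
  have := left_k false; have := left_k true; rewrite !hspinE /pair_admissible /= => /eqP-> /eqP-> /=.
  have /forallP/(_ k) := bend; rewrite !hspinE => -> /=.
  by have := charges k; rewrite charge_gammaE csE residue_eqz.
split.
  apply/and4P; split; apply/forallP => k.
  - have /and4P[/negPf left1 /negPf left2 _ _] := pairs k.
    by apply/forallP => -[]; rewrite hspinE ?left1 ?left2.
  - by rewrite vspinE bot ffunE.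
  - by rewrite vspinE top ffunE; case: ifP.
  - by have := pairs k; rewrite !hspinE => /and4P[].
by apply/forallP => k; have := pairs k; rewrite charge_gammaE csE residue_eqz => /and4P[].
Qed.
End State.

(** For fixed vertical edges, conditions and weights factor over the double rows, so the sum over
    horizontal spins is a product of sums. *)
Lemma partition_functionE :
  partition_function m.+1 v g lam z cs
  = \sum_(V : {ffun 'I_(r.*2).+1 -> cols}) (boundary V)%:R *
      \prod_k pair_weight v gI (z k) (c k)
        (V (top_edge k false)) (V (top_edge k true)) (V (bottom_edge k true)).
Proof.
rewrite /partition_function big_mkcond.
transitivity (\sum_(s : state r N) (admissible lam s && left_charges m.+1 s cs)%:R * weight m.+1 v g z s).
  by apply: eq_bigr => s _; case: ifP; rewrite ?mul1r ?mul0r.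
rewrite sum_assemble exchange_big; apply: eq_bigr => V _ /=.
under [in RHS]eq_bigr do rewrite -sum_pair pair_bigA.
rewrite bigA_distr_bigA mulr_sumr; apply: eq_bigr => H _ /=.
rewrite admissible_weight weight_assemble -mulnb natrM -mulrA; congr (_ * _).
rewrite [RHS]big_split /=; congr (_ * _).
case: (boolP [forall k, _]) => [/forallP pairs|/forallPn [k /negPf pair]].
  by rewrite big1 // => k _; rewrite pairs.
by rewrite (bigD1 k) //= pair mul0r.
Qed.
End PartitionFunction.

(** * Exchanging adjacent double rows *)

Section AdjacentPairs.
Variables (F : fieldType) (r : nat) (T : finType) (i j : 'I_r).
Variable bd : {ffun 'I_(r.*2).+1 -> T} -> F.
Local Notation path := {ffun 'I_(r.*2).+1 -> T}.
Local Notation pair_weights := ('I_r -> T -> T -> T -> F).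
Implicit Types (V U : path) (A : pair_weights).

Hypothesis hij : j = i.+1 :> nat.
Hypothesis bd_ends : forall V U, V ord0 = U ord0 -> V ord_max = U ord_max -> bd V = bd U.

(** A path lists the rows of vertical edges from top to bottom; [T] stands for the spins of one such
    row. *)
Definition path_sum A : F :=
  \sum_V bd V * \prod_k A k (V (top_edge k false)) (V (top_edge k true)) (V (bottom_edge k true)).

Definition strip_sum A t b : F := \sum_s1 \sum_p \sum_s2 A i t s1 p * A j p s2 b.

Lemma top_edge_val (k : 'I_r) (b : bool) : top_edge k b = (k.*2 + b)%N :> nat.
Proof. by rewrite inordK // ltnS; have := ltn_ord k; case: b; lia. Qed.

Lemma bottom_edge_val (k : 'I_r) : bottom_edge k true = k.*2.+2 :> nat.
Proof. by rewrite inordK ?addn1 // ltnS; have := ltn_ord k; lia. Qed.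

Definition set_strip U (x : T * T * T) : path :=
  [ffun q => if q == top_edge i true then x.1.1
             else if q == top_edge j false then x.1.2
             else if q == top_edge j true then x.2 else U q].

Lemma ord_neq k (q q' : 'I_k) : q <> q' :> nat -> (q == q') = false.
Proof. by move=> qq'; apply/eqP => /(congr1 (@nat_of_ord _)). Qed.

(** Paths are grouped by their values outside the strip; the representative of a class has the base
    point [x0] at the three inner places. *)
Lemma sum_set_strip (x0 : T) (f : path -> F) :
  \sum_V f V = \sum_(U | set_strip U (x0, x0, x0) == U) \sum_x f (set_strip U x).
Proof.
have setK U x y : set_strip (set_strip U x) y = set_strip U y.
  apply/ffunP => q; rewrite !ffunE.
  by case: (q == _) => //; case: (q == _) => //; case: (q == _).
rewrite (partition_big (set_strip^~ (x0, x0, x0)) (fun U => set_strip U (x0, x0, x0) == U)); last first.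
  by move=> V _; rewrite setK.
apply: eq_bigr => U /eqP UE.
rewrite (reindex_onto (set_strip U)
    (fun V => (V (top_edge i true), V (top_edge j false), V (top_edge j true)))).
  apply: eq_bigl => -[[s1 p] s2]; rewrite setK UE eqxx !ffunE /= !eqxx.
  by rewrite !ord_neq ?top_edge_val ?hij ?eqxx //; lia.
move=> V /eqP <-; apply/ffunP => q; rewrite !ffunE /=.
by do 3!case: eqP => [->|_] //.
Qed.

Lemma path_sumE (x0 : T) A :
  path_sum A = \sum_(U | set_strip U (x0, x0, x0) == U)
    bd U * (\prod_(k | (k != i) && (k != j))
              A k (U (top_edge k false)) (U (top_edge k true)) (U (bottom_edge k true)))
    * strip_sum A (U (top_edge i false)) (U (bottom_edge j true)).
Proof.
rewrite /path_sum (sum_set_strip x0); apply: eq_bigr => U _.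
have out x (q : 'I_(r.*2).+1) : q <> top_edge i true :> nat -> q <> top_edge j false :> nat ->
    q <> top_edge j true :> nat -> set_strip U x q = U q.
  by move=> q1 q2 q3; rewrite ffunE !ord_neq.
have at1 x : set_strip U x (top_edge i true) = x.1.1 by rewrite ffunE eqxx.
have at2 x : set_strip U x (top_edge j false) = x.1.2.
  by rewrite ffunE eqxx ord_neq // !top_edge_val hij; lia.
have at3 x : set_strip U x (top_edge j true) = x.2.
  by rewrite ffunE eqxx !ord_neq // !top_edge_val hij; lia.
have bottom_i : bottom_edge i true = top_edge j false.
  by apply: ord_inj; rewrite bottom_edge_val top_edge_val hij; lia.
have j_lt := ltn_ord j; rewrite hij in j_lt.
rewrite /strip_sum pair_bigA pair_bigA /= mulr_sumr; apply: eq_bigr => x _.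
(* The three inner places lie strictly between 0 and 2r, so the boundary factor does not see
   them. *)
rewrite (@bd_ends _ U); [|apply: out; rewrite ?top_edge_val ?hij /=; lia ..].
rewrite -mulrA; congr (_ * _).
rewrite (bigD1 i) //= (bigD1 j) /=; last by rewrite ord_neq // hij; lia.
rewrite mulrA mulrC bottom_i at1 at2 at3 !out ?bottom_edge_val ?top_edge_val ?hij; [|lia ..].
congr (_ * _); apply: eq_bigr => k /andP[ki kj].
have {ki} ki : (k : nat) <> i by move=> /ord_inj /eqP; rewrite (negPf ki).
have {kj} kj : (k : nat) <> i.+1 by rewrite -hij => /ord_inj /eqP; rewrite (negPf kj).
by rewrite !out // ?bottom_edge_val ?top_edge_val ?hij; lia.
Qed.

(** The weights outside the strip are a common factor, so a linear relation between strips with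
    fixed outer edges extends to the sums over all paths. *)
Lemma path_sum_linear (A1 A2 A3 : pair_weights) (a1 a2 a3 : F) (x0 : T) :
  (forall k, k != i -> k != j -> A1 k = A3 k /\ A2 k = A3 k) ->
  (forall t b, a1 * strip_sum A1 t b + a2 * strip_sum A2 t b = a3 * strip_sum A3 t b) ->
  a1 * path_sum A1 + a2 * path_sum A2 = a3 * path_sum A3.
Proof.
move=> same strips; rewrite !(path_sumE x0) !mulr_sumr -big_split; apply: eq_bigr => U _ /=.
rewrite [RHS]mulrCA -strips mulrDr.
by congr (_ + _); rewrite mulrCA; congr (_ * _ * _); apply: eq_bigr => k /andP[ki kj];
  case: (same k ki kj) => E1 E2; rewrite ?E1 ?E2.
Qed.
End AdjacentPairs.

(** * Return from residues to integer charges, and the two cases of the functional equation *)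

Theorem theorem5 (R : realType) (n r : nat) (v : R[i]) (g : int -> R[i])
    (lam : r.-tuple nat) (z : 'I_r -> R[i]) (c : 'I_r -> int)
    (i j : 'I_r) (e : nat)
    (n_odd : odd n)
    (r_ge1 : (1 <= r)%N)
    (v_neq0 : v != 0)
    (g_periodic : forall a : int, g (a + n%:Z) = g a)
    (g0 : g 0 = - v)
    (g_inv : forall a : int, ~~ (n%:Z %| a)%Z -> g a * g (n%:Z - a) = v)
    (lam_partition : sorted geq lam)
    (z_neq0 : forall k, z k != 0)
    (c_range : forall k, 0 <= c k < n%:Z)
    (hij : j = i.+1 :> nat)
    (e_lt : (e < n)%N)
    (e_def : (e%:Z = c i - c j %[mod n%:Z])%Z) :
  let Z := partition_function n v g lam in
  (c i <> c j ->
     (1 - v) * z i ^+ (n - e) * z j ^+ e * Z z c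
       + g (c i - c j) * (z j ^+ n - z i ^+ n) * Z z (swap i j c)
     = (z j ^+ n - v * z i ^+ n) * Z (swap i j z) c)
  /\
  (c i = c j ->
     (z i ^+ n - v * z j ^+ n) * Z z c
     = (z j ^+ n - v * z i ^+ n) * Z (swap i j z) c).
Proof.
case: n n_odd g_periodic g_inv c_range e_lt e_def => // m m_odd g_per g_inv' c_rng e_lt' e_def' Z.
pose gI (x : 'I_m.+1) := g x%:Z.
have gI0 : gI 0 = - v by [].
have gIN (x : 'I_m.+1) : x != 0 -> gI x * gI (- x) = v.
  move=> x0; have x_gt0 : (0 < x)%N by rewrite lt0n.
  have x_ndvd : ~~ (m.+1%:Z %| x%:Z)%Z by rewrite dvdzE /= gtnNdvd // ltn_ord.
  rewrite /gI -(g_inv' _ x_ndvd) subzn; last exact/ltnW/ltn_ord.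
  by rewrite /= modn_small // ltn_subrL x_gt0.
pose cI k : 'I_m.+1 := inZp `|c k|%N.
have cE k : c k = (cI k)%:Z.
  have /andP[c_ge0 c_lt] := c_rng k.
  by rewrite /= modn_small ?gez0_abs // -ltz_nat gez0_abs.
pose path := {ffun 'I_(r.*2).+1 -> {ffun 'I_(head 0%N lam + r) -> bool}}.
pose bd (V : path) : R[i] := (boundary V)%:R.
have bd_ends (V U : path) : V ord0 = U ord0 -> V ord_max = U ord_max -> bd V = bd U.
  by move=> V0 Vm; rewrite /bd /boundary V0 Vm.
have ZE z' c' (cI' : 'I_r -> 'I_m.+1) : (forall k, c' k = (cI' k)%:Z) ->
    Z z' c' = path_sum bd (fun k => pair_weight v gI (z' k) (cI' k)).
  exact: partition_functionE.
have swap_i (T : Type) (x : 'I_r -> T) : swap i j x i = x j by rewrite /swap tpermL.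
have swap_j (T : Type) (x : 'I_r -> T) : swap i j x j = x i by rewrite /swap tpermR.
have swap_k (T : Type) (x : 'I_r -> T) k : k != i -> k != j -> swap i j x k = x k.
  by move=> ki kj; rewrite /swap tpermD // eq_sym.
(* One identity covers both cases. It is [strip_exchange_all] at [z j], [z i], so that its left-hand
   strip has the exchanged parameters. *)
have exchange : mono v (z j) (z i) (cI j - cI i) * Z z c
    + gI (cI i - cI j) * (z j ^+ m.+1 - z i ^+ m.+1) * Z z (swap i j c)
    = (z j ^+ m.+1 - v * z i ^+ m.+1) * Z (swap i j z) c.
  rewrite (ZE z c cI) // (ZE (swap i j z) c cI) // (ZE _ _ (swap i j cI)) => [|k]; last exact: cE.
  apply: (path_sum_linear hij bd_ends [ffun=> false]) => [k ki kj|t b].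
    by rewrite !swap_k.
  rewrite /strip_sum !swap_i !swap_j.
  exact/esym/(strip_exchange_all gI0 gIN m_odd (cI i) (cI j) t b (z_neq0 j) (z_neq0 i)).
(* The difference of charges may be negative; adding n gives a natural number, which [inZp] can
   reduce. *)
have gE : g (c i - c j) = gI (cI i - cI j).
  have cj_le : (cI j <= m.+1)%N by apply/ltnW/ltn_ord.
  have -> : cI i - cI j = inZp (cI i + (m.+1 - cI j)) by apply: val_inj; rewrite /= modnDmr.
  rewrite /gI -(g_residue g_per) -(g_per (c i - c j)) !cE PoszD -subzn //; congr (g _); ring.
split=> cij.
  have diffE : cI i - cI j = inZp e.
    apply/(canLR (addrK _))/esym/eqP; rewrite -[X in _ + X]valZpK -inZpD -residue_eqz PoszD -!cE.
    by apply/eqP; rewrite -modzDml e_def' modzDml subrK.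
  have diff_neq0 : cI i - cI j != 0.
    by rewrite subr_eq0; apply: contra_notN cij => /eqP cIij; rewrite !cE cIij.
  (* Here e is nonzero and represents the opposite difference, so negation gives n - e. *)
  have rhoE : rho (cI j - cI i) = (m.+1 - e)%N.
    by rewrite -opprB rhoN // /rho (negPf diff_neq0) diffE /= modn_small.
  rewrite -exchange gE /mono rhoE subKn; last exact: ltnW.
  by congr (_ * _ + _); ring.
have cIij : cI i = cI j by rewrite /cI cij.
have ZswapE : Z z (swap i j c) = Z z c.
  rewrite !(ZE _ _ cI) // => k; rewrite -cE.
  have [->|ki] := eqVneq k i; first by rewrite swap_i.
  by have [->|kj] := eqVneq k j; [rewrite swap_j | rewrite swap_k].
(* At equal charges the coefficient is (1 - v) z_i^n - v (z_j^n - z_i^n) = z_i^n - v z_j^n. *)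
rewrite -exchange ZswapE cIij subrr mono0 gI0; ring.
Qed.
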